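(* Let $W$ be a $d$-dimensional Brownian motion ($d\ge1$ arbitrary) and $T>0$. For every $\varepsilon\in(0,1)$ the Itô integral $\int_0^T\langle\varphi(W_t),dW_t\rangle$ has a pathwise redefinition on the space $C^{1+\varepsilon}(\mathbb{R}^d)$.
   Context: Test functions are vector fields $\mathbb{R}^d\to\mathbb{R}^d$; $W$ starts at $0$ and is defined on a complete probability space $(\Omega,\mathcal F,P)$. $C^{1+\varepsilon}(\mathbb{R}^d)$ is the Banach space of all continuously differentiable $f$ on $\mathbb{R}^d$ with $$\|f\|_{C^{1+\varepsilon}}=\sup_{x}\left(|f(x)|+|Df(x)|\right)+\sup_{x\ne y}\frac{|Df(x)-Df(y)|}{|x-y|^\varepsilon}<\infty .$$ Pathwise redefinition on $V=C^{1+\varepsilon}(\mathbb{R}^d)$: there exists a measurable map $\xi:\Omega\to V'$ such that for every $\varphi\in C^{1+\varepsilon}(\mathbb{R}^d)$, $\int_0^T\langle\varphi(W_t),dW_t\rangle(\omega)=(\xi(\omega))(\varphi)$ for $P$-a.e. $\omega\in\Omega$. *)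

(* Defs.v *)
From HB Require Import structures.
From mathcomp Require Import all_boot all_order all_algebra.
From mathcomp Require Import all_classical all_reals all_analysis.
From mathcomp Require Import ring lra.

Set Implicit Arguments.
Unset Strict Implicit.
Unset Printing Implicit Defensive.

Import Order.TTheory GRing.Theory Num.Theory.
Import numFieldNormedType.Exports.

Local Open Scope classical_set_scope.
Local Open Scope ring_scope.

(* The library norm on matrices is the sup norm; [enorm] is the Euclidean norm
   of a row vector, and the Hilbert-Schmidt norm of a Jacobian matrix. *)
Section euclidean_norm.
Context {R : realType} {m n : nat}.
Implicit Types A B : 'M[R]_(m, n).

Definition enorm A : R := Num.sqrt (\sum_i \sum_j A i j ^+ 2).

Let ssq A := \sum_(p : 'I_m * 'I_n) A p.1 p.2 ^+ 2.

Let enormE A : enorm A = Num.sqrt (ssq A).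
Proof. by rewrite /enorm pair_big. Qed.

Let ssq_ge0 A : 0 <= ssq A.
Proof. by apply: sumr_ge0 => p _; exact: sqr_ge0. Qed.

Let cauchy_schwarz A B :
  (\sum_(p : 'I_m * 'I_n) A p.1 p.2 * B p.1 p.2) ^+ 2 <= ssq A * ssq B.
Proof.
set C := \sum_p _; have [B0|] := eqVneq (ssq B) 0.
  have C0 : C = 0.
    apply: big1 => p _; have /eqP := B0.
    rewrite psumr_eq0; last by move=> q _; exact: sqr_ge0.
    move=> /allP/(_ p (mem_index_enum p)); rewrite sqrf_eq0 => /eqP ->.
    by rewrite mulr0.
  by rewrite C0 B0 mulr0 expr0n.
rewrite neq_lt ltNge ssq_ge0/= => B0; rewrite -subr_ge0 -(pmulr_rge0 _ B0).
have : 0 <= \sum_(p : 'I_m * 'I_n) (ssq B * A p.1 p.2 - C * B p.1 p.2) ^+ 2.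
  by apply: sumr_ge0 => p _; exact: sqr_ge0.
congr (0 <= _).
transitivity (\sum_(p : 'I_m * 'I_n) (ssq B ^+ 2 * A p.1 p.2 ^+ 2 +
   ((- (2 * ssq B * C)) * (A p.1 p.2 * B p.1 p.2) + C ^+ 2 * B p.1 p.2 ^+ 2))).
  by apply: eq_bigr => p _; ring.
rewrite big_split/= big_split/= -!mulr_sumr -/C -/(ssq A) -/(ssq B); ring.
Qed.

Lemma enorm_ge0 A : 0 <= enorm A. Proof. exact: sqrtr_ge0. Qed.

Lemma enorm0_eq0 A : enorm A = 0 -> A = 0.
Proof.
rewrite enormE => /eqP; rewrite sqrtr_eq0 => A0.
have /eqP : ssq A = 0 by apply/eqP; rewrite eq_le A0 ssq_ge0.
rewrite psumr_eq0; last by move=> q _; exact: sqr_ge0.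
move=> /allP A00; apply/matrixP => i j; rewrite mxE.
by have := A00 (i, j) (mem_index_enum _); rewrite sqrf_eq0 => /eqP.
Qed.

Lemma enormZ (c : R) A : enorm (c *: A) = `|c| * enorm A.
Proof.
rewrite !enormE -sqrtr_sqr -sqrtrM ?sqr_ge0//; congr Num.sqrt.
by rewrite /ssq mulr_sumr; apply: eq_bigr => p _; rewrite mxE exprMn.
Qed.

Lemma enorm0 : enorm 0 = 0.
Proof. by rewrite -(scale0r 0) enormZ normr0 mul0r. Qed.

Lemma ler_enormD A B : enorm (A + B) <= enorm A + enorm B.
Proof.
rewrite -(@ler_pXn2r _ 2)// ?nnegrE ?addr_ge0 ?enorm_ge0//.
rewrite sqrrD !enormE !sqr_sqrtr ?ssq_ge0//.
have -> : ssq (A + B) =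
    ssq A + (\sum_(p : 'I_m * 'I_n) A p.1 p.2 * B p.1 p.2) *+ 2 + ssq B.
  rewrite /ssq -sumrMnl -!big_split/=; apply: eq_bigr => p _.
  by rewrite mxE sqrrD.
rewrite lerD2r lerD2l lerMn2r/= -sqrtrM ?ssq_ge0//.
apply: le_trans (ler_norm _) _; rewrite -sqrtr_sqr ler_sqrt//.
by rewrite mulr_ge0.
Qed.

End euclidean_norm.

Definition dotrv {R : realType} {n : nat} (u v : 'rV[R]_n) : R :=
  \sum_i u ord0 i * v ord0 i.

(* Dimensions are written [d.+1] so that the suprema range over nonempty sets. *)
Section C1e.
Context {R : realType} (d : nat) (e : R).
Local Notation E := 'rV[R]_d.+1.
Implicit Types f g : E -> E.

Definition C1e_norm f : \bar R :=
  (ereal_sup [set (enorm (f x) + enorm ('J f x))%:E | x in [set: E]] +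
   ereal_sup [set (enorm ('J f xy.1 - 'J f xy.2) / enorm (xy.1 - xy.2) `^ e)%:E
             | xy in [set xy : E * E | xy.1 != xy.2]])%E.

Definition is_C1e f : Prop :=
  [/\ forall x, differentiable f x, continuous (fun x => 'J f x)
    & (C1e_norm f < +oo)%E].

Let J0 x : 'J (0 : E -> E) x = 0.
Proof.
apply/matrixP => i j; rewrite /jacobian.
have -> : (0 : E -> E) = cst 0 by [].
by rewrite !mxE diff_cst mxE.
Qed.

Let JE f x i j : 'J f x i j = ('d f x : E -> E) (delta_mx 0 i) 0 j.
Proof. by rewrite /jacobian mxE. Qed.

Let addE m n (A B : 'M[R]_(m, n)) i j : (A + B) i j = A i j + B i j.
Proof. by rewrite mxE. Qed.

Let scaleE m n c (A : 'M[R]_(m, n)) i j : (c *: A) i j = c * A i j.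
Proof. by rewrite mxE. Qed.

Let JD f g x : differentiable f x -> differentiable g x ->
  'J (f + g) x = 'J f x + 'J g x.
Proof.
move=> df dg; apply/matrixP => i j; apply: (etrans (JE (f + g) x i j)).
apply/esym/(etrans (addE ('J f x) ('J g x) i j)).
rewrite (diffD df dg); apply: (etrans (f_equal2 +%R (JE f x i j) (JE g x i j))).
exact/esym/(addE ('d f x (delta_mx 0 i)) ('d g x (delta_mx 0 i)) 0 j).
Qed.

Let JZ (c : R) f x : differentiable f x -> 'J (c *: f) x = c *: 'J f x.
Proof.
move=> df; apply/matrixP => i j; apply: (etrans (JE (c *: f) x i j)).
apply/esym/(etrans (scaleE c ('J f x) i j)).
rewrite (diffZ c df); apply: (etrans (f_equal ( *%R c) (JE f x i j))).
exact/esym/(scaleE c ('d f x (delta_mx 0 i)) 0 j).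
Qed.

Let a f x := enorm (f x) + enorm ('J f x).
Let b f (xy : E * E) :=
  enorm ('J f xy.1 - 'J f xy.2) / enorm (xy.1 - xy.2) `^ e.
Let D := [set xy : E * E | xy.1 != xy.2].

Let D0 : D !=set0.
Proof.
exists (const_mx 1, 0); rewrite /D/=; apply/eqP => /matrixP/(_ ord0 ord0).
by rewrite !mxE => /eqP; rewrite oner_eq0.
Qed.

Let a_ge0 f x : 0 <= a f x. Proof. by rewrite addr_ge0// enorm_ge0. Qed.
Let b_ge0 f xy : 0 <= b f xy.
Proof. by rewrite divr_ge0// ?enorm_ge0// powR_ge0. Qed.

Let S T (A : set T) (u : T -> R) := ereal_sup [set (u x)%:E | x in A].

Let S_ge0 T (A : set T) (u : T -> R) :
  A !=set0 -> (forall x, 0 <= u x) -> (0 <= S A u)%E.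
Proof.
move=> [x Ax] u0; apply: (@le_trans _ _ (u x)%:E); first by rewrite lee_fin.
by apply: ereal_sup_ubound; exists x.
Qed.

Let S_ub T (A : set T) (u : T -> R) x : A x -> ((u x)%:E <= S A u)%E.
Proof. by move=> Ax; apply: ereal_sup_ubound; exists x. Qed.

Let S_le T (A : set T) (u v w : T -> R) : (forall x, A x -> u x <= v x + w x) ->
  (S A u <= S A v + S A w)%E.
Proof.
move=> uvw; apply: ge_ereal_sup => _ [x Ax <-].
apply: (@le_trans _ _ ((v x)%:E + (w x)%:E)%E).
  by rewrite -EFinD lee_fin uvw.
by apply: leeD; exact: S_ub.
Qed.

Let S_leZ T (A : set T) (u v : T -> R) (c : R) : 0 <= c ->
  (forall x, A x -> u x <= c * v x) -> (S A u <= c%:E * S A v)%E.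
Proof.
move=> c0 uv; apply: ge_ereal_sup => _ [x Ax <-].
apply: (@le_trans _ _ (c%:E * (v x)%:E)%E); first by rewrite -EFinM lee_fin uv.
by apply: lee_wpmul2l; [rewrite lee_fin|exact: S_ub].
Qed.

Let NE f : C1e_norm f = (S setT (a f) + S D (b f))%E. Proof. by []. Qed.

Let T0 : [set: E] !=set0. Proof. by exists 0. Qed.

Lemma C1e_norm_ge0 f : (0 <= C1e_norm f)%E.
Proof. exact: adde_ge0 (S_ge0 T0 (a_ge0 f)) (S_ge0 D0 (b_ge0 f)). Qed.

Let ND f g : (forall x, differentiable f x) -> (forall x, differentiable g x) ->
  (C1e_norm (f + g)%R <= C1e_norm f + C1e_norm g)%E.
Proof.
move=> df dg; rewrite !NE addeACA; apply: leeD; apply: S_le.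
  move=> x _; rewrite /a JD// addrACA lerD// ?ler_enormD//.
move=> xy _; rewrite /b !JD// -mulrDl ler_wpM2r ?invr_ge0 ?powR_ge0//.
by rewrite opprD addrACA ler_enormD.
Qed.

Let NZ c f : (forall x, differentiable f x) ->
  (C1e_norm (c *: f)%R <= `|c|%:E * C1e_norm f)%E.
Proof.
move=> df; rewrite !NE.
rewrite (ge0_muleDr _ (S_ge0 T0 (a_ge0 f)) (S_ge0 D0 (b_ge0 f))).
apply: leeD; apply: S_leZ => //.
  by move=> x _; rewrite /a JZ// mulrDr !enormZ.
by move=> xy _; rewrite /b !JZ// -scalerBr enormZ mulrA.
Qed.

Definition C1e_pred : {pred E -> E} := fun f => `[< is_C1e f >].

Let C1e_submod : GRing.subsemimod_closed C1e_pred.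
Proof.
split; first split.
- apply/asboolP; split.
  + by move=> x; exact: differentiable_cst.
  + by rewrite (_ : (fun x => _) = cst 0); [exact: cst_continuous|exact/funext].
  + apply: (@le_lt_trans _ _ 0%E); last by rewrite ltry.
    rewrite NE -(adde0 0%E); apply: leeD; apply: ge_ereal_sup => _ [x _ <-].
      by rewrite /a J0 lee_fin !enorm0 addr0.
    by rewrite /b !J0 subr0 enorm0 mul0r.
- move=> f g /asboolP[df cf nf] /asboolP[dg cg ng]; apply/asboolP; split.
  + by move=> x; exact: differentiableD.
  + rewrite (_ : (fun x => _) = fun x => 'J f x + 'J g x).
      by move=> x; exact: (cvgD (cf x) (cg x)).
    by apply/funext => x; exact: JD.
  + exact: (le_lt_trans (ND df dg) (lte_add_pinfty nf ng)).
- move=> c f /asboolP[df cf nf]; apply/asboolP; split.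
  + by move=> x; exact: differentiableZ.
  + rewrite (_ : (fun x => _) = fun x => c *: 'J f x).
      move=> x; exact: (@cvgZl_tmp R 'M[R]_d.+1 E (nbhs x) _ c
        (fun x => 'J f x) ('J f x) (cf x)).
    by apply/funext => x; exact: JZ.
  + have cnf : (`|c|%:E * C1e_norm f < +oo)%E by rewrite lte_mul_pinfty.
    exact: (le_lt_trans (NZ c df) cnf).
Qed.

HB.instance Definition _ := GRing.isSubmodClosed.Build R (E -> E) C1e_pred
  C1e_submod.

Record C1e := MkC1e { C1e_fun :> E -> E ; _ : C1e_fun \in C1e_pred }.

HB.instance Definition _ := [isSub for C1e_fun].
HB.instance Definition _ := [Choice of C1e by <:].
HB.instance Definition _ := [SubChoice_isSubLmodule of C1e by <:].

Let C1eP (f : C1e) : is_C1e f. Proof. by case: f => f /= /asboolP. Qed.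

Let norm (f : C1e) : R := fine (C1e_norm f).

Let norm_fin (f : C1e) : C1e_norm f \is a fin_num.
Proof. by rewrite ge0_fin_numE ?C1e_norm_ge0//; have [] := C1eP f. Qed.

Let normE (f : C1e) : (norm f)%:E = C1e_norm f.
Proof. exact: fineK (norm_fin f). Qed.

Let fine_leD (x y z : \bar R) : x \is a fin_num -> y \is a fin_num ->
  z \is a fin_num -> (x <= y + z)%E -> fine x <= fine y + fine z.
Proof.
by move: x y z => [x| |] [y| |] [z| |]//= _ _ _; rewrite -EFinD lee_fin.
Qed.

Let fine_leZ (x y : \bar R) (c : R) : x \is a fin_num -> y \is a fin_num ->
  (x <= c%:E * y)%E -> fine x <= c * fine y.
Proof. by move: x y => [x| |] [y| |]//= _ _; rewrite -EFinM lee_fin. Qed.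

Let normD (f g : C1e) : norm (f + g) <= norm f + norm g.
Proof.
have [[df _ _] [dg _ _]] := (C1eP f, C1eP g).
exact: (fine_leD (norm_fin (f + g)) (norm_fin f) (norm_fin g) (ND df dg)).
Qed.

Let normZ_le (c : R) (f : C1e) : norm (c *: f) <= `|c| * norm f.
Proof.
have [df _ _] := C1eP f.
exact: (fine_leZ (norm_fin (c *: f)) (norm_fin f) (NZ c df)).
Qed.

Let norm_ge0 (f : C1e) : 0 <= norm f.
Proof. by rewrite -lee_fin normE C1e_norm_ge0. Qed.

Let normZ (c : R) (f : C1e) : norm (c *: f) = `|c| * norm f.
Proof.
apply/eqP; rewrite eq_le normZ_le/=; have [->|c0] := eqVneq c 0.
  by rewrite normr0 mul0r.
rewrite -ler_pdivlMl ?normr_gt0// -normfV.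
by rewrite -{1}(scalerK c0 f); exact: normZ_le.
Qed.

Let norm0_eq0 (f : C1e) : norm f = 0 -> f = 0.
Proof.
move=> f0; apply: val_inj; apply/funext => x /=; apply: enorm0_eq0.
apply/eqP; rewrite eq_le enorm_ge0 andbT -f0 -lee_fin normE NE.
apply: (@le_trans _ _ (a f x)%:E); first by rewrite lee_fin lerDl enorm_ge0.
by rewrite -[leLHS]adde0; apply: leeD; [exact: S_ub|exact: (S_ge0 D0 (b_ge0 f))].
Qed.

HB.instance Definition _ := Lmodule_isNormed.Build R C1e normD normZ norm0_eq0.

Lemma C1e_normE (f : C1e) : (`|f|)%:E = C1e_norm f. Proof. exact: normE. Qed.

End C1e.

Section dual.
Context {R : realType} (V : normedModType R).

Definition dual_pred : {pred V -> R^o} :=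
  fun l => `[< linear l /\ continuous l >].

Let dual_submod : GRing.subsemimod_closed dual_pred.
Proof.
split; first split.
- apply/asboolP; split; last exact: cst_continuous.
  by move=> c u v; rewrite scaler0 addr0.
- move=> f g /asboolP[lf cf] /asboolP[lg cg]; apply/asboolP; split.
    move=> c u v; transitivity (f (c *: u + v) + g (c *: u + v)) => //.
    by rewrite lf lg addrACA -scalerDr.
  by move=> x; exact: (cvgD (cf x) (cg x)).
- move=> c f /asboolP[lf cf]; apply/asboolP; split.
    move=> k u v; transitivity (c *: f (k *: u + v)) => //.
    by rewrite lf scalerDr !scalerA mulrC -scalerA.
  by move=> x; exact: (@cvgZl_tmp R R^o V (nbhs x) _ c f (f x) (cf x)).
Qed.

HB.instance Definition _ := GRing.isSubmodClosed.Build R (V -> R^o) dual_pred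
  dual_submod.

Record dual := MkDual { dual_fun :> V -> R^o ; _ : dual_fun \in dual_pred }.

HB.instance Definition _ := [isSub for dual_fun].
HB.instance Definition _ := [Choice of dual by <:].
HB.instance Definition _ := [SubChoice_isSubLmodule of dual by <:].

Definition dual_norm (l : dual) : R :=
  sup [set `|l v| | v in [set v : V | `|v| <= 1]].

Let dual_linear (l : dual) : linear l.
Proof. by case: l => l /= /asboolP[]. Qed.

Let dual_continuous (l : dual) : continuous l.
Proof. by case: l => l /= /asboolP[]. Qed.

Let dual0 (l : dual) : l 0 = 0.
Proof. by have := dual_linear l 1 0 0; rewrite !scale1r addr0 => /eqP;
  rewrite -subr_eq subrr => /eqP. Qed.

Let dual_scale (l : dual) c v : l (c *: v) = c *: l v.
Proof. by have := dual_linear l c v 0; rewrite !addr0 dual0 addr0. Qed.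

Let dual_has_sup (l : dual) :
  has_sup [set `|l v| | v in [set v : V | `|v| <= 1]].
Proof.
split; first by exists `|l 0|, 0 => //=; rewrite normr0.
have /cvgrPdist_lt/(_ 1 ltr01) := @dual_continuous l 0.
move=> /nbhs_norm0P[r /= r0 rl]; exists (2 / r) => _ [v /= v1 <-].
have r20 : 0 < r / 2 by rewrite divr_gt0.
have := rl ((r / 2) *: v); rewrite /= normrZ gtr0_norm// => /(_ _)/ltW.
rewrite dual0 sub0r normrN dual_scale normrZ (gtr0_norm r20).
rewrite -ler_pdivlMl// mulr1 invf_div; apply.
apply: (@le_lt_trans _ _ (r / 2)); first by rewrite ler_piMr// ltW.
by rewrite ltr_pdivrMr// ltr_pMr// ltr1n.
Qed.

Let dual_norm_ub (l : dual) v : `|v| <= 1 -> `|l v| <= dual_norm l.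
Proof.
by move=> v1; apply: ub_le_sup; [case: (dual_has_sup l)|exists v].
Qed.

Let dual_norm_le (l : dual) M : (forall v, `|v| <= 1 -> `|l v| <= M) ->
  dual_norm l <= M.
Proof.
move=> lM; apply: ge_sup; first by case: (dual_has_sup l).
by move=> _ [v /= v1 <-]; exact: lM.
Qed.

Let dual_normD (l k : dual) : dual_norm (l + k) <= dual_norm l + dual_norm k.
Proof.
apply: dual_norm_le => v v1; apply: le_trans (ler_normD _ _) _.
by apply: lerD; exact: dual_norm_ub.
Qed.

Let dual_normZ_le c (l : dual) : dual_norm (c *: l) <= `|c| * dual_norm l.
Proof.
apply: dual_norm_le => v v1; rewrite [leLHS](normrZ c (l v)).
by apply: ler_wpM2l => //; exact: dual_norm_ub.
Qed.

Let dual_norm_ge0 (l : dual) : 0 <= dual_norm l.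
Proof.
by apply: le_trans (@dual_norm_ub l 0 _); rewrite ?normr_ge0// normr0.
Qed.

Let dual_normZ c (l : dual) : dual_norm (c *: l) = `|c| * dual_norm l.
Proof.
apply/eqP; rewrite eq_le dual_normZ_le/=; have [->|c0] := eqVneq c 0.
  by rewrite normr0 mul0r dual_norm_ge0.
rewrite -ler_pdivlMl ?normr_gt0// -normfV.
by rewrite -{1}(scalerK c0 l); exact: dual_normZ_le.
Qed.

Let dual_norm0_eq0 (l : dual) : dual_norm l = 0 -> l = 0.
Proof.
move=> l0; apply: val_inj; apply/funext => v /=.
have [->|v0] := eqVneq v 0; first by rewrite dual0.
have nv0 : `|v| != 0 by rewrite normr_eq0.
have := @dual_norm_ub l (`|v|^-1 *: v).
rewrite l0 normrZ normfV normr_id mulVf// => /(_ (lexx _)).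
rewrite normr_le0 dual_scale scaler_eq0 invr_eq0 (negbTE nv0)/=.
by move=> /eqP.
Qed.

HB.instance Definition _ :=
  Lmodule_isNormed.Build R dual dual_normD dual_normZ dual_norm0_eq0.

Lemma dual_normE (l : dual) : `|l| = dual_norm l. Proof. by []. Qed.

End dual.

Definition borel (T : ptopologicalType) := g_sigma_algebraType (@open T).

Section brownian_motion.
Context {d : measure_display} {Omega : measurableType d} {R : realType}.
Variable n : nat.
Implicit Types (X : Omega -> 'rV[R]_n) (F : set (set Omega)).

Definition rv_coord X (i : 'I_n) : Omega -> R := fun w => X w ord0 i.

(* [X] is measurable from the sigma-algebra [F] to the Borel sets of R^n. *)
Definition rv_measurable F X : Prop :=
  forall i (B : set R), measurable B -> F (rv_coord X i @^-1` B).

Definition sigma_rv X : set (set Omega) :=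
  <<s \bigcup_(i in [set: 'I_n])
        preimage_set_system setT (rv_coord X i) measurable >>.

(* Only the times [t >= 0] of a process [W : R -> Omega -> R^n] are relevant. *)
Definition natural_filtration (W : R -> Omega -> 'rV[R]_n) (t : R) :
    set (set Omega) :=
  <<s \bigcup_(s in `[0, t]) sigma_rv (W s) >>.

Definition independent (P : probability Omega R) F G : Prop :=
  forall A B, F A -> G B -> P (A `&` B) = (P A * P B)%E.

(* [X] has law N(0, v * Id): its coordinates are independent with law N(0, v).
   The second parameter of [normal_prob] is the standard deviation. *)
Definition centered_normal (P : probability Omega R) (v : R) X : Prop :=
  forall B : 'I_n -> set R, (forall i, measurable (B i)) ->
    P (\bigcap_(i in [set: 'I_n]) rv_coord X i @^-1` B i) =
    (\prod_(i < n) normal_prob 0 (Num.sqrt v) (B i))%E.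

Record brownian_motion (P : probability Omega R) (W : R -> Omega -> 'rV[R]_n) :
    Prop := BrownianMotion {
  bm_measurable : forall t, 0 <= t -> rv_measurable measurable (W t) ;
  bm_start : {ae P, forall w, W 0 w = 0} ;
  bm_continuous : {ae P, forall w, {within `[0, +oo[, continuous (W ^~ w)}} ;
  bm_independent : forall s t, 0 <= s -> s < t ->
    independent P (natural_filtration W s)
                  (sigma_rv (fun w => W t w - W s w)) ;
  bm_normal : forall s t, 0 <= s -> s < t ->
    centered_normal P (t - s) (fun w => W t w - W s w) }.

End brownian_motion.

Section ito_integral.
Context {d : measure_display} {Omega : measurableType d} {R : realType}.
Variables (n : nat) (P : probability Omega R).
Variables (F : R -> set (set Omega)) (W : R -> Omega -> 'rV[R]_n) (T : R).

(* The elementary process (t, w) |-> coef w * 1_]start, stop](t). *)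
Record elementary := Elementary {
  el_start : R ;
  el_stop : R ;
  el_coef : Omega -> 'rV[R]_n }.

Definition elementary_adapted (e : elementary) : Prop :=
  [/\ 0 <= el_start e, el_start e <= el_stop e, el_stop e <= T,
      rv_measurable (F (el_start e)) (el_coef e)
    & exists M : R, forall w, enorm (el_coef e w) <= M].

(* A simple process is a finite sum of elementary ones; the intervals may
   overlap. *)
Definition simple_process := seq elementary.

Definition simple_adapted (H : simple_process) : Prop :=
  List.Forall elementary_adapted H.

Definition simple_value (H : simple_process) (t : R) (w : Omega) : 'rV[R]_n :=
  \sum_(e <- H) (\1_(`]el_start e, el_stop e] : set R) t *: el_coef e w).

Definition simple_integral (H : simple_process) (w : Omega) : R :=
  \sum_(e <- H) dotrv (el_coef e w) (W (el_stop e) w - W (el_start e) w).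

Definition ito_sqdist (H : simple_process) (X : R -> Omega -> 'rV[R]_n) :
    \bar R :=
  (\int[P]_w \int[lebesgue_measure]_(t in [set` `[0%R, T]])
     ((enorm (simple_value H t w - X t w) ^+ 2)%R)%:E)%E.

(* [I] is a version of int_0^T <X_t, dW_t>: the L^2(P) limit of the integrals of
   adapted simple processes that converge to [X] in L^2([0, T] x Omega). *)
Definition is_ito_integral (X : R -> Omega -> 'rV[R]_n) (I : Omega -> R) :
    Prop :=
  measurable_fun setT I /\
  exists H : nat -> simple_process,
    [/\ forall k, simple_adapted (H k),
        ito_sqdist (H k) X @[k --> \oo] --> 0%E
      & (\int[P]_w ((simple_integral (H k) w - I w) ^+ 2)%:E)%E
          @[k --> \oo] --> 0%E].

End ito_integral.

(* [J phi] is the set of versions of a random variable that is defined up to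
   almost sure equality. The dual carries the Borel sets of its norm. *)
Definition has_pathwise_redefinition {d : measure_display}
    {Omega : measurableType d} {R : realType} (P : probability Omega R)
    (V : normedModType R) (J : V -> set (Omega -> R)) : Prop :=
  exists xi : Omega -> dual V,
    measurable_fun setT (xi : Omega -> borel (dual V)) /\
    forall phi : V, exists2 I, J phi I & {ae P, forall w, I w = xi w phi}.

(* Main.v *)
Require Import Defs.
From HB Require Import structures.
From mathcomp Require Import all_boot all_order all_algebra.
From mathcomp Require Import all_classical all_reals all_analysis.
From mathcomp Require Import measurable_realfun simple_functions.
From mathcomp Require Import measurable_fun_approximation ring lra zify.

Set Implicit Arguments.
Unset Strict Implicit.
Unset Printing Implicit Defensive.

Import Order.TTheory GRing.Theory Num.Theory.
Import numFieldNormedType.Exports.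

Local Open Scope classical_set_scope.
Local Open Scope ring_scope.

(** The point is to bound the Riemann sums of the integral along dyadic times,
    uniformly over the unit ball of C^{1+e}. Let S_n(phi) be the left-point
    Riemann sum of phi(W) against dW over the 2^n dyadic intervals of [0, T].
    When level n is refined to level n + 1, every interval is cut into two
    halves with increments x_k and y_k, and

      S_{n+1}(phi) - S_n(phi) = sum_k <phi(w_k + x_k) - phi(w_k), y_k>

    where w_k is the left end of the path. By Taylor's formula this is
    sum_k <x_k J(w_k), y_k>, with J the Jacobian matrix of phi, up to an error
    of at most |phi| sum_k |x_k|^(1+e) |y_k| ([C1e_taylor]).

    The entries of J(w_k) depend on phi, so the products x_k y_k cannot be
    averaged against them for all phi at once by orthogonality. They are
    instead summed by parts along the dyadic tree ([dyadic_chaining]): the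
    values of J change by at most |phi| |x|^e from a node to its right child,
    and are multiplied by sums of x_k y_k over whole dyadic blocks, which no
    longer depend on phi. The terms of a block are orthogonal martingale
    increments, so that a block of level m has mean square of order 2^(-n-m)
    ([transform_second_moment], [block_mean]). Altogether

      |S_{n+1}(phi) - S_n(phi)| <= |phi| K_n   with   E K_n <= C q^n,

    where q = 2^(-e/2) < 1 ([riemann_sum_refinement],
    [refinement_bound_mean]). Almost surely the K_n are therefore summable, and
    S_n then converges in the norm of the dual space; the limit is the pathwise
    integral ([pathwise_integral]). Second moments of the coordinates of the
    increments suffice: neither Hoelder continuity of the paths nor the Levy
    area is used.

    The dual space is not separable, so Borel measurability of the limit
    deserves care. Each S_n is the composition of a norm-continuous map, defined
    on a finite-dimensional space of matrices, with a random matrix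
    ([riemann_functional_continuous], [open_measurable_matrix]), and pointwise
    limits of Borel maps with values in a normed space are Borel
    ([open_measurable_lim]).

    Finally, for a fixed phi, the sums S_n(phi) are the integrals of simple
    adapted processes. These converge to phi(W) in mean square by dominated
    convergence ([dyadic_process_sqdist]), and S_n(phi) converges in mean square
    to its almost sure limit, by a bound of Ito isometry type and Fatou's lemma
    ([riemann_sum_L2]). *)

(** * Moments of the normal law *)

Section density.
Import HBNNSimple.
Local Open Scope ereal_scope.
Context d (T : measurableType d) (R : realType).
Variables mu nu : {measure set T -> \bar R}.

(** Integration against a measure with density [g] with respect to [mu]. *)
Lemma ge0_integral_density (g : T -> R) (f : T -> \bar R) :
  measurable_fun setT g -> (forall x, 0 <= g x)%R ->
  (forall A, measurable A -> nu A = \int[mu]_(x in A) (g x)%:E) ->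
  measurable_fun setT f -> (forall x, 0 <= f x) ->
  \int[nu]_x f x = \int[mu]_x (f x * (g x)%:E).
Proof.
move=> mg g0 nuE mf f0.
pose f_ := nnsfun_approx measurableT mf.
have f_f x : (f_ n x)%:E @[n --> \oo] --> f x by exact: cvg_nnsfun_approx.
transitivity (limn (fun n => \int[nu]_x (f_ n x)%:E)).
  rewrite -monotone_convergence//=.
  - by apply: eq_integral => x _; exact/esym/cvg_lim.
  - by move=> n; exact/measurable_EFinP/measurable_funTS.
  - by move=> n x _; rewrite lee_fin.
  - by move=> x _ m n mn; rewrite lee_fin; exact/lefP/nd_nnsfun_approx.
transitivity (limn (fun n => \int[mu]_x ((f_ n x)%:E * (g x)%:E))); last first.
  rewrite -monotone_convergence//=.
  - apply: eq_integral => x _; apply/cvg_lim => //.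
    by apply: cvgeZr => //; exact: f_f.
  - move=> n; apply/emeasurable_funM => //; apply/measurable_EFinP => //.
  - by move=> n x _; rewrite -EFinM lee_fin mulr_ge0.
  - move=> x _ m n mn; rewrite -!EFinM lee_fin ler_wpM2r//.
    exact/lefP/nd_nnsfun_approx.
congr (limn _); apply/funext => n.
under eq_integral do rewrite fimfunE -fsumEFin// .
have mr (r : R) : measurable (f_ n @^-1` [set r]) by exact: measurable_sfunP.
rewrite ge0_integral_fsum//; last 2 first.
  - by move=> r; apply/measurable_EFinP; exact: measurable_funM.
  - by move=> r x _; rewrite EFinM nnfun_muleindic_ge0.
under [RHS]eq_integral.
  move=> x _; rewrite fimfunE -fsumEFin// ge0_mule_fsuml; last first.
    by move=> r; rewrite EFinM nnfun_muleindic_ge0.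
  over.
rewrite [RHS]ge0_integral_fsum//; last 2 first.
  - move=> r; apply/emeasurable_funM; apply/measurable_EFinP => //.
    exact: measurable_funM.
  - move=> r x _; apply: mule_ge0; last by rewrite lee_fin.
    by rewrite EFinM nnfun_muleindic_ge0.
apply: eq_fsbigr => r /[!inE] -[t _ <-].
under eq_integral do rewrite EFinM.
rewrite ge0_integralZl ?lee_fin//; last exact/measurable_EFinP/measurable_indic.
rewrite integral_indic// setIT nuE//.
under [RHS]eq_integral do rewrite EFinM -muleA.
rewrite ge0_integralZl ?lee_fin//; last 2 first.
  - by apply/emeasurable_funM; apply/measurable_EFinP.
  - by move=> x _; rewrite mule_ge0// lee_fin.
congr (_ * _); rewrite integral_mkcond.
apply: eq_integral => x _; rewrite patchE indicE.
by case: (x \in _); rewrite ?mul1e ?mul0e.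
Qed.

End density.

Section normal_moments.
Context {R : realType}.
Local Notation mu := (@lebesgue_measure R).

(** Gaussian tails absorb the square: with u = x / s, one has
    u^2 exp(- u^2 / 2) <= 4 exp(- u^2 / 4), and the right-hand side is up to a
    constant the density of the centred normal law of standard deviation
    sqrt 2 s. *)
Lemma normal_second_moment (s : R) : 0 < s ->
  (\int[normal_prob 0 s]_x ((x ^+ 2)%:E : \bar R) <= (8 * s ^+ 2)%:E)%E.
Proof.
move=> s0.
have mX : measurable_fun setT (fun x : measurableTypeR R => (x ^+ 2)%:E).
  by apply/measurable_EFinP; exact: exprn_measurable.
rewrite (@ge0_integral_density _ _ R mu (normal_prob 0 s) (normal_pdf 0 s))//=; last 3 first.
  - exact: measurable_normal_pdf.
  - by move=> x; exact: normal_pdf_ge0.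
  - by move=> x; rewrite lee_fin sqr_ge0.
set s' := Num.sqrt 2 * s.
have r20 : 0 < Num.sqrt 2 :> R by rewrite sqrtr_gt0.
have s'0 : 0 < s' by rewrite mulr_gt0.
have peak : normal_peak s = Num.sqrt 2 * normal_peak s'.
  rewrite /normal_peak /s' exprMn sqr_sqrtr//.
  have -> : 2 * s ^+ 2 * pi *+ 2 = 2 * (s ^+ 2 * pi *+ 2) by ring.
  rewrite sqrtrM// invfM.
  by rewrite mulrA divff ?mul1r// gt_eqF.
apply: (@le_trans _ _ (\int[mu]_x ((8 * s ^+ 2)%:E * (normal_pdf 0 s' x)%:E))%E); last first.
  rewrite ge0_integralZl//=.
  - by rewrite integral_normal_pdf mule1.
  - by apply/measurable_EFinP; exact: measurable_normal_pdf.
  - by move=> x _; rewrite lee_fin normal_pdf_ge0.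
  - by rewrite lee_fin mulr_ge0// sqr_ge0.
apply: ge0_le_integral => //=.
- by move=> x _; rewrite -EFinM lee_fin mulr_ge0 ?sqr_ge0 ?normal_pdf_ge0.
- apply: emeasurable_funM => //; apply/measurable_EFinP.
  exact: measurable_normal_pdf.
- apply: emeasurable_funM => //; apply/measurable_EFinP.
  exact: measurable_normal_pdf.
move=> x _; rewrite -!EFinM lee_fin !normal_pdfE ?gt_eqF//.
rewrite peak /normal_fun !subr0 /s' exprMn sqr_sqrtr//.
have s20 : s ^+ 2 != 0 by rewrite expf_neq0// gt_eqF.
set u := x ^+ 2 / (s ^+ 2 * 4).
have -> : - x ^+ 2 / (s ^+ 2 *+ 2) = - u - u.
  by rewrite /u; field; rewrite gt_eqF.
have -> : - x ^+ 2 / (2 * s ^+ 2 *+ 2) = - u.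
  by rewrite /u; field; rewrite gt_eqF.
have -> : x ^+ 2 = s ^+ 2 * 4 * u by rewrite /u; field; rewrite gt_eqF.
have u0 : 0 <= u by apply: divr_ge0; [exact: sqr_ge0|apply: mulr_ge0 => //; exact: sqr_ge0].
have u1 : u * expR (- u) <= 1.
  rewrite expRN ler_pdivrMr ?expR_gt0// mul1r.
  by apply: le_trans (expR_ge1Dx u); rewrite lerDr.
have r2 : Num.sqrt 2 <= 2 :> R.
  by rewrite -[leRHS]ger0_norm// -sqrtr_sqr ler_sqrt// expr2; lra.
set p := normal_peak _; set v := expR (- u) in u1 *.
rewrite expRD -/v.
have -> : s ^+ 2 * 4 * u * (Num.sqrt 2 * p * (v * v)) =
  s ^+ 2 * 4 * p * v * (Num.sqrt 2 * (u * v)) by ring.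
have -> : 8 * s ^+ 2 * (p * v) = s ^+ 2 * 4 * p * v * (2 * 1) by ring.
apply: ler_wpM2l; first by rewrite !mulr_ge0 ?normal_peak_ge0 ?expR_ge0 ?exprn_ge0// ltW.
have uv0 : 0 <= u * v by apply: mulr_ge0 => //; exact: expR_ge0.
exact: ler_pM (sqrtr_ge0 _) uv0 r2 u1.
Qed.

(** The centred normal law is symmetric, because the Lebesgue measure is. *)
Lemma normal_probN (s : R) (A : set (measurableTypeR R)) : s != 0 ->
  measurable A ->
  pushforward (normal_prob 0 s)
    (-%R : measurableTypeR R -> measurableTypeR R) A = normal_prob 0 s A.
Proof.
move=> s0 mA; rewrite /pushforward /normal_prob.
have mpdf : measurable_fun A (fun x : measurableTypeR R => (normal_pdf 0 s x)%:E).
  by apply/measurable_funTS/measurable_EFinP; exact: measurable_normal_pdf.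
transitivity (\int[pushforward mu (-%R : measurableTypeR R -> measurableTypeR R)]_(x in A)
    (normal_pdf 0 s x)%:E)%E.
  rewrite ge0_integral_pushforward//; last first.
    by move=> y _; rewrite lee_fin normal_pdf_ge0.
  apply: eq_integral => x _; rewrite /= !normal_pdfE// /normal_fun.
  by rewrite !subr0 sqrrN.
by apply: eq_measure_integral => B mB _; exact: lebesgue_measureN.
Qed.

Lemma integrable_normal_id (s : R) : 0 < s ->
  (normal_prob 0 s).-integrable setT (EFin : measurableTypeR R -> \bar R).
Proof.
move=> s0; have mid : measurable_fun setT (EFin : measurableTypeR R -> \bar R).
  exact/measurable_EFinP.
have mX : measurable_fun setT (fun x : measurableTypeR R => (x ^+ 2)%:E).
  by apply/measurable_EFinP; exact: exprn_measurable.
apply/integrableP; split=> //.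
apply: (@le_lt_trans _ _ (\int[normal_prob 0 s]_x (cst 1 x + (x ^+ 2)%:E))%E).
  apply: ge0_le_integral => //=.
  - by apply: measurableT_comp.
  - by apply: emeasurable_funD.
  - move=> x _; rewrite -EFinD lee_fin -(@ler_pXn2r _ 2)// ?nnegrE ?addr_ge0 ?sqr_ge0//.
    by rewrite real_normK ?num_real//; have := sqr_ge0 x; nra.
rewrite ge0_integralD//=; last by move=> x _; rewrite lee_fin sqr_ge0.
have -> : (\int[normal_prob 0 s]_x (1%:E : \bar R) = 1)%E.
  by rewrite integral_cst// mul1e; exact: (@probability_setT _ _ _ (normal_prob 0 s)).
by rewrite lte_add_pinfty ?ltry//; exact: le_lt_trans (normal_second_moment s0) (ltry _).
Qed.

Lemma normal_mean0 (s : R) : 0 < s ->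
  (\int[normal_prob 0 s]_x (x%:E : \bar R) = 0)%E.
Proof.
move=> s0; have iN := integrable_normal_id s0.
pose opp := -%R : measurableTypeR R -> measurableTypeR R.
have mopp : measurable_fun setT opp by exact: oppr_measurable.
have E : (\int[normal_prob 0 s]_x x%:E = \int[normal_prob 0 s]_x (- x%:E) :> \bar R)%E.
  transitivity (\int[pushforward (normal_prob 0 s) opp]_x x%:E)%E.
    apply: eq_measure_integral => A mA _; apply/esym/normal_probN => //.
    by rewrite gt_eqF.
  rewrite integral_pushforward//=.
  by rewrite preimage_setT; have := integrableN iN; exact: eq_integrable.
have fin := integrable_fin_num measurableT iN.
move: E; rewrite integralN /=; last exact: integrable_add_def.
move: fin; case: (integral _ _ _) => //= r _ [] /eqP; rewrite -subr_eq0 opprK.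
by rewrite -mulr2n mulrn_eq0/= => /eqP ->.
Qed.

End normal_moments.

(** * Products of independent random variables *)

Section independent_product.
Context d (Omega : measurableType d) (R : realType) (P : probability Omega R).
Variables X Y : Omega -> R.
Hypotheses (mX : measurable_fun setT X) (mY : measurable_fun setT Y).
Hypothesis XY : forall A B : set R, measurable A -> measurable B ->
  (P (X @^-1` A `&` Y @^-1` B) = P (X @^-1` A) * P (Y @^-1` B))%E.

Let X' : {RV P >-> R} := HB.pack X (isMeasurableFun.Build _ _ _ _ X mX).
Let Y' : {RV P >-> R} := HB.pack Y (isMeasurableFun.Build _ _ _ _ Y mY).
Let XY2 w := (X w, Y w).

Let mXY2 : measurable_fun setT XY2.
Proof. exact: measurable_fun_pair. Qed.

Let prod_law (A : set (measurableTypeR R * measurableTypeR R)) : measurable A ->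
  (distribution P X' \x distribution P Y')%E A = pushforward P XY2 A.
Proof.
apply: (@product_measure_unique _ _ _ _ R (distribution P X')
  (distribution P Y') (pushforward P XY2)) => A1 A2 mA1 mA2.
exact: XY.
Qed.

(** Independence makes the joint law of [X] and [Y] the product of their laws,
    so that Tonelli's and Fubini's theorems apply. *)
Lemma independent_integral_normM :
  (\int[P]_w (`|X w * Y w|)%:E =
   \int[P]_w (`|X w|)%:E * \int[P]_w (`|Y w|)%:E)%E.
Proof.
pose f (z : measurableTypeR R * measurableTypeR R) : \bar R := (`|z.1 * z.2|)%:E.
have mf : measurable_fun setT f.
  apply/measurable_EFinP.  apply: (measurableT_comp (@normr_measurable R setT)). 
  exact: measurable_funM.
have mabs : measurable_fun setT (fun x : measurableTypeR R => (`|x|)%:E : \bar R).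
  by apply/measurable_EFinP; exact: normr_measurable.
transitivity (\int[pushforward P XY2]_z f z)%E.
  by rewrite ge0_integral_pushforward// => z _; rewrite /f lee_fin.
transitivity (\int[(distribution P X' \x distribution P Y')]_z f z)%E.
  by apply: eq_measure_integral => A mA _; exact/esym/prod_law.
rewrite fubini_tonelli1//=; last by move=> z; rewrite lee_fin.
rewrite /fubini_F /f/=.
under eq_integral.
  move=> x _; under eq_integral do rewrite normrM EFinM.
  rewrite ge0_integralZl//; over.
rewrite ge0_integralZr//; last by apply: integral_ge0 => y _; rewrite lee_fin.
by rewrite !ge0_integral_distribution.
Qed.

Lemma independent_integrableM :
  P.-integrable setT (EFin \o X) -> P.-integrable setT (EFin \o Y) ->
  P.-integrable setT (fun w => (X w * Y w)%:E).
Proof.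
move=> /integrableP[_ iX] /integrableP[_ iY]; apply/integrableP; split.
  exact/measurable_EFinP/measurable_funM.
rewrite [ltLHS]independent_integral_normM lte_mul_pinfty//.
- by apply: integral_ge0 => w _; rewrite lee_fin.
- by rewrite ge0_fin_numE//; apply: integral_ge0 => w _; rewrite lee_fin.
Qed.

Lemma independent_integralM0 :
  P.-integrable setT (EFin \o X) -> P.-integrable setT (EFin \o Y) ->
  (\int[P]_w (Y w)%:E = 0)%E -> (\int[P]_w (X w * Y w)%:E = 0)%E.
Proof.
move=> iX iY Y0.
have iXY := independent_integrableM iX iY.
pose f (z : measurableTypeR R * measurableTypeR R) : \bar R := (z.1 * z.2)%:E.
have mf : measurable_fun setT f.
  by apply/measurable_EFinP; exact: measurable_funM.
have mE : measurable_fun setT (EFin : measurableTypeR R -> \bar R).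
  exact/measurable_EFinP.
have ipf : (pushforward P XY2).-integrable setT f.
  by apply: integrable_pushforward.
transitivity (\int[pushforward P XY2]_z f z)%E.
  by rewrite integral_pushforward.
transitivity (\int[(distribution P X' \x distribution P Y')]_z f z)%E.
  by apply: eq_measure_integral => A mA _; exact/esym/prod_law.
rewrite -integral12_prod_meas1//=; last first.
  case/integrableP: ipf => _ ipf; apply/integrableP; split => //.
  apply: le_lt_trans ipf; rewrite le_eqVlt; apply/orP; left; apply/eqP.
  by apply: eq_measure_integral => A mA _; exact: prod_law.
rewrite (_ : fubini_F _ _ = cst 0%E) ?integral_cst ?mul0e//.
apply/funext => x; rewrite /fubini_F /f/=.
under eq_integral do rewrite EFinM.
rewrite integralZl//=; last exact: integrable_pushforward.
by rewrite integral_distribution//= Y0 mule0.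
Qed.

End independent_product.

(** * Second moments and orthogonality of Brownian increments *)

Section second_moments.
Local Open Scope ereal_scope.
Context d (Omega : measurableType d) (R : realType) (P : probability Omega R).
Implicit Types X Y : Omega -> R.

Lemma integrable_of_second_moment X : measurable_fun setT X ->
  \int[P]_w (X w ^+ 2)%:E < +oo -> P.-integrable setT (EFin \o X).
Proof.
move=> mX X2; have mX2 : measurable_fun setT (fun w => (X w ^+ 2)%:E).
  exact/measurable_EFinP/measurable_funX.
apply/integrableP; split; first exact/measurable_EFinP.
apply: (@le_lt_trans _ _ (\int[P]_w (cst 1 w + (X w ^+ 2)%:E))).
  apply: ge0_le_integral => //=.
  - by apply/measurable_EFinP; exact: measurableT_comp.
  - by apply: emeasurable_funD.
  - move=> w _; rewrite -EFinD lee_fin -(@ler_pXn2r _ 2)// ?nnegrE ?addr_ge0 ?sqr_ge0//.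
    by rewrite real_normK ?num_real//; have := sqr_ge0 (X w); nra.
rewrite ge0_integralD//=; last by move=> w _; rewrite lee_fin sqr_ge0.
by rewrite integral_cst// mul1e lte_add_pinfty// [ltLHS]probability_setT ltry.
Qed.

Lemma integrableM_of_second_moments X Y :
  measurable_fun setT X -> measurable_fun setT Y ->
  \int[P]_w (X w ^+ 2)%:E < +oo -> \int[P]_w (Y w ^+ 2)%:E < +oo ->
  P.-integrable setT (fun w => (X w * Y w)%:E).
Proof.
move=> mX mY X2 Y2; have mX2 : measurable_fun setT (fun w => (X w ^+ 2)%:E).
  exact/measurable_EFinP/measurable_funX.
have mY2 : measurable_fun setT (fun w => (Y w ^+ 2)%:E).
  exact/measurable_EFinP/measurable_funX.
have mXY : measurable_fun setT (fun w => (X w * Y w)%:E).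
  exact/measurable_EFinP/measurable_funM.
apply/integrableP; split => //.
apply: (@le_lt_trans _ _ (\int[P]_w ((X w ^+ 2)%:E + (Y w ^+ 2)%:E))).
  apply: ge0_le_integral => //=.
  - by apply/measurable_EFinP; apply: measurableT_comp => //; exact/measurable_EFinP.
  - by apply: emeasurable_funD.
  - move=> w _; rewrite -EFinD lee_fin normrM.
    rewrite -(real_normK (num_real (X w))) -(real_normK (num_real (Y w))).
    have := sqr_ge0 (`|X w| - `|Y w|)%R; have := normr_ge0 (X w); have := normr_ge0 (Y w); nra.
rewrite ge0_integralD//=; [|by move=> w _; rewrite lee_fin sqr_ge0..].
by rewrite lte_add_pinfty.
Qed.

Lemma second_moment_orthogonal X Y :
  measurable_fun setT X -> measurable_fun setT Y ->
  \int[P]_w (X w ^+ 2)%:E < +oo -> \int[P]_w (Y w ^+ 2)%:E < +oo ->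
  \int[P]_w (X w * Y w)%:E = 0 ->
  \int[P]_w ((X w + Y w) ^+ 2)%:E =
  \int[P]_w (X w ^+ 2)%:E + \int[P]_w (Y w ^+ 2)%:E.
Proof.
move=> mX mY X2 Y2 XY0; have iXY := integrableM_of_second_moments mX mY X2 Y2.
have i2 (Z : Omega -> R) : measurable_fun setT Z ->
    \int[P]_w (Z w ^+ 2)%:E < +oo -> P.-integrable setT (fun w => (Z w ^+ 2)%:E).
  move=> mZ Z2; apply/integrableP; split.
    exact/measurable_EFinP/measurable_funX.
  by under eq_integral do rewrite gee0_abs ?lee_fin ?sqr_ge0//.
under eq_integral => w _.
  rewrite (_ : ((X w + Y w) ^+ 2)%R = (X w ^+ 2 + Y w ^+ 2 + 2 * (X w * Y w))%R); last by ring.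
  rewrite EFinD EFinD [(2 * _)%:E]EFinM; over.
rewrite integralD//=; last 2 first.
- by apply: integrableD => //; exact: i2.
- exact: integrableZl.
rewrite integralZl// XY0 mule0 adde0 integralD//; exact: i2.
Qed.

End second_moments.

Section brownian_increments.
Context d (Omega : measurableType d) (R : realType) (P : probability Omega R).
Variables (n : nat) (W : R -> Omega -> 'rV[R]_n).
Hypothesis hW : brownian_motion P W.

(** Coordinate [i] of the increment of the path between [s] and [t]. *)
Definition increment s t (i : 'I_n) (w : Omega) : R := (W t w - W s w) ord0 i.

(** The random variable [X] is measurable for the natural filtration of [W]
    at time [t]. *)
Definition adapted t (X : Omega -> R) : Prop :=
  measurable_fun setT
    (X : g_sigma_algebraType (\bigcup_(s in `[0, t]) sigma_rv (W s)) -> R).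

Lemma adaptedP t X : adapted t X <->
  forall B : set R, measurable B -> natural_filtration W t (X @^-1` B).
Proof.
split=> [aX B mB|aX _ B mB]; last by rewrite setTI; exact: aX.
by rewrite -[X in natural_filtration _ _ X]setTI; exact: aX.
Qed.

Lemma natural_filtration_measurable t A : natural_filtration W t A -> measurable A.
Proof.
apply: smallest_sub; first exact: sigma_algebra_measurable.
move=> {}A [s /=]; rewrite in_itv/= => /andP[s0 _].
apply: smallest_sub; first exact: sigma_algebra_measurable.
move=> {}A [i _ [B mB <-]]; rewrite setTI.
exact: (bm_measurable hW s0 i mB).
Qed.

Lemma adapted_measurable t X : adapted t X -> measurable_fun setT X.
Proof.
move=> /adaptedP aX _ B mB; rewrite setTI.
by apply: (@natural_filtration_measurable t); exact: aX.
Qed.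

Lemma adapted_le s t X : s <= t -> adapted s X -> adapted t X.
Proof.
move=> st /adaptedP aX; apply/adaptedP => B /aX.
apply: sub_sigma_algebra2 => A [r /=]; rewrite in_itv/= => /andP[r0 rs] ?.
by exists r => //=; rewrite in_itv/= r0 (le_trans rs).
Qed.

Lemma adapted_coord s t i : 0 <= s -> s <= t -> adapted t (fun w => W s w ord0 i).
Proof.
move=> s0 st; apply/adaptedP => B mB; apply: sub_sigma_algebra.
exists s => /=; first by rewrite in_itv/= s0.
apply: sub_sigma_algebra; exists i => //; exists B => //.
by rewrite setTI.
Qed.

Lemma adapted_increment r s t i : 0 <= r -> 0 <= s -> r <= t -> s <= t ->
  adapted t (increment r s i).
Proof.
move=> r0 s0 rt st.
rewrite (_ : increment r s i = fun w => W s w ord0 i - W r w ord0 i).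
  by apply: measurable_funB; exact: adapted_coord.
by apply/funext => w; rewrite /increment !mxE.
Qed.

Lemma measurable_increment s t i : 0 <= s -> 0 <= t -> measurable_fun setT (increment s t i).
Proof.
move=> s0 t0; apply: (@adapted_measurable (Num.max s t)).
by apply: adapted_increment; rewrite // le_max lexx ?orbT.
Qed.

Lemma increment_independent s t i X : 0 <= s -> s < t -> adapted s X ->
  forall A B : set R, measurable A -> measurable B ->
  (P (X @^-1` A `&` increment s t i @^-1` B) =
   P (X @^-1` A) * P (increment s t i @^-1` B))%E.
Proof.
move=> s0 st /adaptedP aX A B mA mB.
apply: (bm_independent hW s0 st); first exact: aX.
by apply: sub_sigma_algebra; exists i => //; exists B => //; rewrite setTI.
Qed.

Lemma increment_law s t i (B : set R) : 0 <= s -> s < t -> measurable B ->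
  P (increment s t i @^-1` B) = normal_prob 0 (Num.sqrt (t - s)) B.
Proof.
move=> s0 st mB.
have := bm_normal hW s0 st (B := fun j => if j == i then B else setT).
rewrite (bigD1 i)//= eqxx big1 ?mule1; last first.
  by move=> j /negbTE ->; exact: (@probability_setT _ _ _ (normal_prob 0 _)).
move=> <-; last by move=> j; case: ifP.
congr (P _); apply/seteqP; split=> [w Bw j _|w /(_ i I)]; last by rewrite /= eqxx.
by rewrite /=; case: eqP => // ->.
Qed.

Section law.
Variables (s t : R) (i : 'I_n).
Hypotheses (s0 : 0 <= s) (st : s < t).
Let y := increment s t i.
Let my : measurable_fun setT y.
Proof. by apply: measurable_increment => //; exact/ltW/(le_lt_trans s0). Qed.
Let sg0 : 0 < Num.sqrt (t - s). Proof. by rewrite sqrtr_gt0 subr_gt0. Qed.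

Lemma increment_second_moment :
  (\int[P]_w (y w ^+ 2)%:E <= (8 * (t - s))%:E)%E.
Proof.
rewrite -[in leRHS](@sqr_sqrtr _ (t - s)); last by rewrite subr_ge0 ltW.
apply: le_trans (normal_second_moment sg0).
have mX : measurable_fun setT (fun x : measurableTypeR R => (x ^+ 2)%:E).
  by apply/measurable_EFinP; exact: exprn_measurable.
rewrite le_eqVlt; apply/orP; left; apply/eqP.
transitivity (\int[pushforward P (y : Omega -> measurableTypeR R)]_(x in setT) (x ^+ 2)%:E)%E.
  by rewrite ge0_integral_pushforward// => x _; rewrite lee_fin sqr_ge0.
by apply: eq_measure_integral => B mB _; exact: (increment_law i s0 st mB).
Qed.

Lemma increment_second_momenty : (\int[P]_w (y w ^+ 2)%:E < +oo)%E.
Proof. exact: le_lt_trans increment_second_moment (ltry _). Qed.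

Lemma integrable_increment : P.-integrable setT (EFin \o y).
Proof. exact: integrable_of_second_moment my increment_second_momenty. Qed.

Lemma increment_mean0 : (\int[P]_w (y w)%:E = 0)%E.
Proof.
rewrite -(normal_mean0 sg0).
transitivity (\int[pushforward P (y : Omega -> measurableTypeR R)]_(x in setT) x%:E)%E.
  by rewrite integral_pushforward//; exact: integrable_increment.
by apply: eq_measure_integral => B mB _; exact: (increment_law i s0 st mB).
Qed.

End law.

(** The past and the increment are independent, so second moments multiply. *)
Lemma second_moment_adaptedM s t i X : 0 <= s -> s < t -> adapted s X ->
  (\int[P]_w ((X w * increment s t i w) ^+ 2)%:E =
   \int[P]_w (X w ^+ 2)%:E * \int[P]_w (increment s t i w ^+ 2)%:E)%E.
Proof.
move=> s0 st aX; have t0 : 0 <= t by exact/ltW/(le_lt_trans s0).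
have aX2 : adapted s (fun w => X w ^+ 2) by exact: measurable_funX.
have mX2 := adapted_measurable aX2.
have mY2 : measurable_fun setT (fun w => increment s t i w ^+ 2).
  by apply: measurable_funX; exact: measurable_increment.
have indep : forall A B : set R, measurable A -> measurable B ->
    P ((fun w => X w ^+ 2) @^-1` A `&` (fun w => increment s t i w ^+ 2) @^-1` B) =
    (P ((fun w => (X w ^+ 2)%R) @^-1` A) *
     P ((fun w => (increment s t i w ^+ 2)%R) @^-1` B))%E.
  move=> A B mA mB.
  have mS : measurable ((fun x : measurableTypeR R => x ^+ 2) @^-1` B).
    by rewrite -[X in measurable X]setTI; exact: exprn_measurable.
  exact: (increment_independent i s0 st aX2 mA mS).
have := independent_integral_normM mX2 mY2 indep.
have -> : (\int[P]_w (`|X w ^+ 2 * increment s t i w ^+ 2|)%:E =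
    \int[P]_w ((X w * increment s t i w) ^+ 2)%:E)%E.
  by apply: eq_integral => w _; rewrite -exprMn ger0_norm// sqr_ge0.
move=> ->.
by congr (_ * _)%E; apply: eq_integral => w _; rewrite ger0_norm// sqr_ge0.
Qed.

(** A martingale transform of Brownian motion along successive intervals
    ]s k, t k]: its terms are orthogonal, because each increment is centred
    and independent of everything that comes before it. *)
Lemma transform_second_moment (s t a : nat -> R) (X : nat -> Omega -> R) i N :
  (forall k, 0 <= s k) -> (forall k, s k < t k) -> (forall k, t k <= s k.+1) ->
  (forall k, adapted (s k) (X k)) ->
  (forall k, \int[P]_w (X k w ^+ 2)%:E <= (a k)%:E)%E ->
  (\int[P]_w ((\sum_(k < N) X k w * increment (s k) (t k) i w) ^+ 2)%:E <=
   (\sum_(k < N) a k * (8 * (t k - s k)))%:E)%E.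
Proof.
move=> s0 st ts aX X2.
have a0 k : 0 <= a k.
  rewrite -lee_fin; apply: le_trans (X2 k).
  by apply: integral_ge0 => w _; rewrite lee_fin sqr_ge0.
pose S N w := \sum_(k < N) X k w * increment (s k) (t k) i w.
have aS m : adapted (s m) (S m).
  elim: m => [|m IH].
    by rewrite /S; under eq_fun do rewrite big_ord0; exact: measurable_cst.
  rewrite /S; under eq_fun do rewrite big_ord_recr/=.
  have sm : s m <= s m.+1 by exact: le_trans (ltW (st m)) (ts m).
  apply: measurable_funD; first exact: adapted_le IH.
  apply: measurable_funM; first exact: adapted_le (aX m).
  by apply: adapted_increment => //; exact: le_trans (ltW (st m)).
elim: N => [|m IH].
  under eq_integral do rewrite big_ord0 expr0n/=.
  by rewrite integral0 big_ord0.
under eq_integral do rewrite big_ord_recr/=.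
have t0 : 0 <= t m by exact: le_trans (s0 m) (ltW (st m)).
have mX := adapted_measurable (aX m).
have my : measurable_fun setT (increment (s m) (t m) i) by exact: measurable_increment.
have mS := adapted_measurable (aS m).
have Xoo := le_lt_trans (X2 m) (ltry _).
have Soo := le_lt_trans IH (ltry _).
have yoo := increment_second_momenty i (s0 m) (st m).
have Xy2 : (\int[P]_w ((X m w * increment (s m) (t m) i w) ^+ 2)%:E <=
    (a m * (8 * (t m - s m)))%:E)%E.
  rewrite second_moment_adaptedM// EFinM; apply: lee_pmul => //.
  - by apply: integral_ge0 => w _; rewrite lee_fin sqr_ge0.
  - by apply: integral_ge0 => w _; rewrite lee_fin sqr_ge0.
  - exact: increment_second_moment.
have mXy : measurable_fun setT (fun w => X m w * increment (s m) (t m) i w).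
  exact: measurable_funM.
have aSX : adapted (s m) (fun w => S m w * X m w).
  by apply: measurable_funM; [exact: aS|exact: aX].
(* the past [S m * X m] is independent of the centred increment *)
have SXy0 : (\int[P]_w (S m w * (X m w * increment (s m) (t m) i w))%:E = 0)%E.
  under eq_integral do rewrite mulrA.
  apply: (independent_integralM0 (adapted_measurable aSX) my).
  - exact: increment_independent.
  - exact: integrableM_of_second_moments.
  - exact: integrable_increment.
  - exact: increment_mean0.
rewrite [leLHS](second_moment_orthogonal mS mXy Soo (le_lt_trans Xy2 (ltry _)) SXy0).
by rewrite big_ord_recr/= EFinD leeD.
Qed.

End brownian_increments.

(** * First-order Taylor expansion of a C^{1+e} vector field *)

Section l1_norm.
Context {R : realType} {n : nat}.
Implicit Types v : 'rV[R]_n.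

(** The sum of the absolute values of the coordinates. *)
Definition l1norm v : R := \sum_i `|v ord0 i|.

Lemma l1norm_ge0 v : 0 <= l1norm v. Proof. exact: sumr_ge0. Qed.

Lemma coord_le_l1norm v i : `|v ord0 i| <= l1norm v.
Proof. by rewrite /l1norm (bigD1 i)//= lerDl sumr_ge0. Qed.

Lemma coord_le_enorm m k (A : 'M[R]_(m, k)) i j : `|A i j| <= enorm A.
Proof.
rewrite /enorm -sqrtr_sqr ler_sqrt; last first.
  by apply: sumr_ge0 => ? _; apply: sumr_ge0 => ? _; exact: sqr_ge0.
rewrite (bigD1 i)//= (bigD1 j)//= -addrA lerDl addr_ge0//.
  by apply: sumr_ge0 => ? _; exact: sqr_ge0.
by apply: sumr_ge0 => ? _; apply: sumr_ge0 => ? _; exact: sqr_ge0.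
Qed.

Lemma enorm_le_l1norm v : enorm v <= l1norm v.
Proof.
rewrite /enorm big_ord1 -[leRHS]ger0_norm ?l1norm_ge0// -sqrtr_sqr.
rewrite ler_sqrt ?sqr_ge0// [leRHS]expr2 {1}/l1norm mulr_suml.
apply: ler_sum => i _; rewrite -real_normK ?num_real// expr2.
by rewrite ler_wpM2l// coord_le_l1norm.
Qed.

End l1_norm.

Section taylor.
Context {R : realType} {d : nat} {e : R}.
Variable f : C1e d e.
Local Notation E := 'rV[R]_d.+1.

Lemma C1eP : is_C1e e f. Proof. by case: f => g /= /asboolP. Qed.

Let C1e_differentiable x : differentiable f x. Proof. by case: C1eP. Qed.

(* Generic versions of [mxE], which would otherwise unfold the Jacobian. *)
Let subE m k (A B : 'M[R]_(m, k)) i j : (A - B) i j = A i j - B i j.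
Proof. by rewrite !mxE. Qed.

Let rv_mulE m k (v : 'rV[R]_m) (A : 'M[R]_(m, k)) j :
  (v *m A) ord0 j = \sum_i v ord0 i * A i j.
Proof. by rewrite mxE. Qed.

Let rv_fE k (F : 'I_1 -> 'I_k -> R) j : (\matrix_(i, j) F i j) ord0 j = F ord0 j.
Proof. by rewrite mxE. Qed.

Let sum_le (a b : \bar R) c : (c <= a)%E -> (0 <= b)%E -> (c <= a + b)%E.
Proof. by move=> ca b0; rewrite -[c]adde0; exact: leeD. Qed.

Let sup1_ge0 : (0 <= ereal_sup
  [set (enorm (f x) + enorm ('J f x))%:E | x in [set: E]])%E.
Proof.
apply: (@le_trans _ _ (enorm (f 0) + enorm ('J f 0))%:E).
  by rewrite lee_fin addr_ge0// enorm_ge0.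
by apply: ereal_sup_ubound; exists 0.
Qed.

Let sup2_ge0 : (0 <= ereal_sup
  [set (enorm ('J f xy.1 - 'J f xy.2) / enorm (xy.1 - xy.2) `^ e)%:E
             | xy in [set xy : E * E | xy.1 != xy.2]])%E.
Proof.
pose z : E * E := (const_mx 1, 0).
apply: (@le_trans _ _ (enorm ('J f z.1 - 'J f z.2) / enorm (z.1 - z.2) `^ e)%:E).
  by rewrite lee_fin divr_ge0 ?enorm_ge0 ?powR_ge0.
apply: ereal_sup_ubound; exists z => //=.
apply/eqP => /matrixP/(_ ord0 ord0).
by rewrite !mxE => /eqP; rewrite oner_eq0.
Qed.

Lemma C1e_sup_bound x : enorm (f x) + enorm ('J f x) <= `|f|.
Proof.
rewrite -lee_fin C1e_normE /C1e_norm; apply: sum_le => //.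
by apply: ereal_sup_ubound; exists x.
Qed.

Lemma C1e_bound x i : `|f x ord0 i| <= `|f|.
Proof.
apply: le_trans (coord_le_enorm _ _ _) _; apply: le_trans (C1e_sup_bound x).
by rewrite lerDl enorm_ge0.
Qed.

Lemma C1e_jacobian_bound x i j : `|'J f x i j| <= `|f|.
Proof.
apply: le_trans (coord_le_enorm _ _ _) _; apply: le_trans (C1e_sup_bound x).
by rewrite lerDr enorm_ge0.
Qed.

Lemma C1e_jacobian_holder x y i j : 0 <= e ->
  `|'J f x i j - 'J f y i j| <= `|f| * l1norm (x - y) `^ e.
Proof.
move=> e0; have [->|xy] := eqVneq x y.
  by rewrite subrr normr0 mulr_ge0// powR_ge0.
apply: (@le_trans _ _ (enorm ('J f x - 'J f y))).
  by rewrite -subE coord_le_enorm.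
have nxy : 0 < enorm (x - y).
  rewrite lt_neqAle enorm_ge0 andbT eq_sym; apply/eqP => /enorm0_eq0 /eqP.
  by rewrite subr_eq0; exact/negP.
apply: (@le_trans _ _ (`|f| * enorm (x - y) `^ e)).
  rewrite -ler_pdivrMr ?powR_gt0// -lee_fin C1e_normE /C1e_norm addeC.
  by apply: sum_le => //; apply: ereal_sup_ubound; exists (x, y).
rewrite ler_wpM2l//; apply: ge0_ler_powR => //; rewrite ?nnegrE ?enorm_ge0 ?l1norm_ge0//.
exact: enorm_le_l1norm.
Qed.

(** The mean value theorem along a segment, one coordinate of [f] at a time. *)
Lemma C1e_mean_value x v j : exists2 c, 0 <= c <= 1 &
  f (x + v) ord0 j - f x ord0 j = \sum_i v ord0 i * 'J f (x + c *: v) i j.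
Proof.
pose g (t : R) := f (x + t *: v) ord0 j.
have dg (t : R) : is_derive t 1 g (\sum_i v ord0 i * 'J f (x + t *: v) i j).
  set a := x + t *: v.
  have da : derivable f a v by exact: diff_derivable.
  have daj : derivable (fun y => f y ord0 j) a v by exact: ((derivable_mxP _ _ _).1 da).
  have Q : (fun h : R => h^-1 *: (g (h *: 1 + t) - g t)) =
      (fun h : R => h^-1 *: (f (h *: v + a) ord0 j - f a ord0 j)).
    apply/funext => h; rewrite /g /a; congr (_ *: (f _ _ _ - _)).
    by rewrite [h *: 1]mulr1 scalerDl addrCA.
  apply: DeriveDef; first by rewrite /derivable Q.
  rewrite /derive Q -/('D_v (fun y => f y ord0 j) a).
  have := deriveEjacobian v (C1e_differentiable a); rewrite derive_mx//.
  by move=> /matrixP/(_ ord0 j); rewrite rv_mulE rv_fE.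
have gc : {within `[0, 1], continuous g}.
  apply: derivable_within_continuous => t _; by case: (dg t).
have [c c01 gE] := MVT_segment ler01 (fun t _ => dg t) gc.
exists c; first by rewrite in_itv/= in c01.
by move: gE; rewrite /g scale1r scale0r addr0 subr0 mulr1.
Qed.

Lemma C1e_lipschitz x v j : `|f (x + v) ord0 j - f x ord0 j| <= `|f| * l1norm v.
Proof.
have [c _ ->] := C1e_mean_value x v j.
apply: le_trans (ler_norm_sum _ _ _) _; rewrite mulrC mulr_suml.
by apply: ler_sum => i _; rewrite normrM ler_wpM2l// C1e_jacobian_bound.
Qed.

Lemma C1e_taylor x v j : 0 <= e ->
  `|f (x + v) ord0 j - f x ord0 j - \sum_i v ord0 i * 'J f x i j| <=
  `|f| * (l1norm v `^ e * l1norm v).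
Proof.
move=> e0; have [c /andP[c0 c1] ->] := C1e_mean_value x v j.
rewrite -sumrB; apply: le_trans (ler_norm_sum _ _ _) _.
rewrite mulrA mulrC mulr_suml; apply: ler_sum => i _.
rewrite -mulrBr normrM ler_wpM2l//.
apply: le_trans (C1e_jacobian_holder _ _ _ _ e0) _.
rewrite ler_wpM2l// addrC addKr.
apply: ge0_ler_powR => //; rewrite ?nnegrE ?l1norm_ge0//.
apply: ler_sum => k _; rewrite mxE normrM ger0_norm//.
by rewrite ler_piMl.
Qed.

End taylor.

(** * Limits and Borel measurability in the dual space *)

Section dual_space.
Context {R : realType} (V : normedModType R).
Implicit Types l : dual V.

Lemma dual_linear l : linear l. Proof. by case: l => l /= /asboolP[]. Qed.

Lemma dual_bounded_in (l : V -> R^o) M : linear l ->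
  (forall v, `|l v| <= M * `|v|) -> l \in @dual_pred R V.
Proof.
move=> ll lM; apply/asboolP; split => // v; apply/cvgrPdist_le => r r0.
have M0 : 0 < `|M| + 1 by rewrite ltr_wpDl.
near=> x.
have -> : l v - l x = l (v - x).
  by rewrite -scaleN1r addrC -ll scaleN1r addrC.
apply: le_trans (lM _) _; apply: (@le_trans _ _ ((`|M| + 1) * `|v - x|)).
  by rewrite ler_wpM2r// (le_trans (ler_norm _))// lerDl.
rewrite -ler_pdivlMl// mulrC.
near: x; apply/nbhs_normP; exists (r / (`|M| + 1)) => /=.
  by rewrite divr_gt0.
by move=> x /=; exact: ltW.
Unshelve. all: by end_near. Qed.

Lemma dual_norm_le l M : 0 <= M -> (forall v, `|l v| <= M * `|v|) -> `|l| <= M.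
Proof.
move=> M0 lM; rewrite dual_normE /dual_norm; apply: ge_sup.
  by exists `|l 0|, 0 => //=; rewrite normr0.
by move=> _ [v /= v1 <-]; apply: le_trans (lM v) _; rewrite ler_piMr.
Qed.

Lemma dual_subE l1 l2 v : (l1 - l2) v = l1 v - l2 v.
Proof. by []. Qed.

Lemma dual_scaleE c l v : (c *: l) v = c * l v. Proof. by []. Qed.

Lemma dual_sumE (I : Type) (r : seq I) (F : I -> dual V) v :
  (\sum_(i <- r) F i) v = \sum_(i <- r) F i v.
Proof.
elim: r => [|i r IH]; first by rewrite !big_nil.
by rewrite !big_cons -IH.
Qed.

(** Telescoping bounds that are summable give a limit in the dual norm; no
    completeness of [V] is needed. *)
Lemma dual_limit (u : nat -> dual V) (K : nat -> R) M0 M :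
  (forall v, `|u 0%N v| <= M0 * `|v|) ->
  (forall n v, `|u n.+1 v - u n v| <= K n * `|v|) ->
  (forall n, 0 <= K n) -> (forall n, \sum_(k < n) K k <= M) ->
  exists l : dual V, u n @[n --> \oo] --> l /\
    forall v, u n v @[n --> \oo] --> l v.
Proof.
move=> u0 uK K0 KM.
pose S := [sequence \sum_(0 <= k < n) K k]_n.
have cS : cvgn S.
  apply: nondecreasing_is_cvgn.
    by apply/nondecreasing_seqP => n; rewrite /S/= big_nat_recr//= lerDl.
  by exists M => _ [n _ <-]; rewrite /S/= big_mkord.
have um n m v : (n <= m)%N -> `|u m v - u n v| <= (S m - S n) * `|v|.
  elim: m => [|m IH].
    by rewrite leqn0 => /eqP ->; rewrite !subrr normr0 mul0r.
  rewrite leq_eqVlt => /predU1P[->|nm]; first by rewrite !subrr normr0 mul0r.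
  rewrite -(subrKA (u m v)); apply: le_trans (ler_normD _ _) _.
  apply: le_trans (lerD (uK _ _) (IH nm)) _.
  by rewrite -mulrDl [S m.+1]/S/= big_nat_recr//= addrA (addrC (K m)).
have cu v : cvgn (fun n => u n v : R).
  have : cvgn (series (fun k => u k.+1 v - u k v : R)).
    have cK : cvgn (series (fun k => K k * `|v|)).
      rewrite (_ : series _ = fun n => S n * `|v|).
        by apply: is_cvgMl => //; exact: is_cvg_cst.
      by apply/funext => n; rewrite /series/= -mulr_suml.
    by apply: normed_cvg; apply: series_le_cvg cK => n;
      [exact: normr_ge0|exact: mulr_ge0|exact: uK].
  move=> c; have -> : (fun n => u n v : R) =
      (fun n => series (fun k => u k.+1 v - u k v : R) n + u 0%N v).
    apply/funext => n; rewrite /series/= telescope_sumr//.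
    by rewrite subrK.
  by apply: is_cvgD => //; exact: is_cvg_cst.
pose l v : R^o := limn (fun n => u n v : R).
have ul v : (u n v : R) @[n --> \oo] --> (l v : R) by exact: cu.
have lb n v : `|l v - u n v| <= (limn S - S n) * `|v|.
  have c1 : `|u m v - u n v| @[m --> \oo] --> `|l v - u n v|.
    by apply: cvg_norm; apply: cvgB => //; exact: cvg_cst.
  have c2 : (S m - S n) * `|v| @[m --> \oo] --> (limn S - S n) * `|v|.
    by apply: cvgMl; apply: cvgB => //; exact: cvg_cst.
  apply: (ler_cvg_to c1 c2); near=> m; apply: um; near: m.
  exact: nbhs_infty_ge.
have ll : linear l.
  move=> c x y; apply/cvg_lim => //.
  rewrite (_ : (fun n => _) = (fun n => c * u n x + u n y)); last first.
    by apply/funext => n; rewrite dual_linear.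
  by apply: cvgD => //; exact: cvgMr.
have lin : l \in @dual_pred R V.
  apply: (@dual_bounded_in _ (M0 + (limn S - S 0%N))) => // v.
  rewrite -[l v](subrK (u 0%N v)) (le_trans (ler_normD _ _))// addrC mulrDl.
  by rewrite lerD.
exists (MkDual lin); split=> [|v]; last exact: ul.
apply/cvgrPdist_le => r r0.
have cS0 : limn S - S n @[n --> \oo] --> 0.
  by rewrite -(subrr (limn S)); apply: cvgB => //; exact: cvg_cst.
move/cvgrPdist_le : cS0 => /(_ _ r0); apply: filterS => n.
rewrite sub0r normrN => Sn; apply: dual_norm_le; first exact: ltW.
move=> v; rewrite dual_subE/=; apply: le_trans (lb n v) _.
by rewrite ler_wpM2r// (le_trans _ Sn)// ler_norm.
Unshelve. all: by end_near. Qed.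

End dual_space.

Section borel_measurability.
Context d (Omega : measurableType d) (R : realType).

(** [X] pulls open sets back to measurable sets. *)
Definition open_measurable_map (M : topologicalType) (X : Omega -> M) : Prop :=
  forall U : set M, open U -> measurable (X @^-1` U).

Lemma borel_measurable_fun (M : ptopologicalType) (X : Omega -> M) :
  open_measurable_map X -> measurable_fun setT (X : Omega -> borel M).
Proof.
move=> mX; apply: (@measurability _ _ Omega (borel M) setT X (@open M) erefl) => // _ [U oU <-].
by rewrite setTI; exact: mX.
Qed.

Lemma open_measurable_continuous (M N : topologicalType) (X : Omega -> M) (g : M -> N) :
  continuous g -> open_measurable_map X -> open_measurable_map (g \o X).
Proof.
move=> cg mX U oU; rewrite comp_preimage; apply: mX.
by move/continuousP : cg; exact.
Qed.

Lemma open_measurable_real (X : Omega -> R) :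
  open_measurable_map X -> measurable_fun setT X.
Proof.
move=> mX; apply: (measurability _ (RGenOpens.measurableE R)) => //.
move=> _ [_ [a [b ->]] <-]; rewrite setTI; apply: mX.
exact: interval_open.
Qed.

(** An open set of matrices is the union of the rational boxes that it
    contains. *)
Lemma open_measurable_matrix p q (X : Omega -> 'M[R]_(p, q)) :
  (forall i j, measurable_fun setT (fun w => X w i j)) ->
  open_measurable_map X.
Proof.
move=> mX U oU.
pose B (c : 'M[rat]_(p, q) * nat) : set 'M[R]_(p, q) :=
  [set x | forall i j, `|x i j - ratr (c.1 i j)| < c.2.+1%:R^-1].
have -> : X @^-1` U =
    \bigcup_(c in [set c | B c `<=` U]) (X @^-1` B c).
  apply/seteqP; split=> [w /= Uw|w [c /= BU Bw]]; last exact: BU.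
  have /nbhs_ballP[r /= r0 rU] : nbhs (X w) U by exact: open_nbhs_nbhs.
  have [k /= kr] : exists k : nat, 2 * k.+1%:R^-1 < r.
    have /archi_boundP : 0 <= 2 / r by rewrite divr_ge0// ltW.
    move=> rk; exists (Num.bound (2 / r)).
    rewrite ltr_pdivrMr// mulrC -ltr_pdivrMr//.
    by apply: lt_trans rk _; rewrite ltr_nat.
  have k0 : 0 < k.+1%:R^-1 :> R by rewrite invr_gt0.
  have /choice[c /= cP] : forall ij : 'I_p * 'I_q, exists q : rat,
      `|X w ij.1 ij.2 - ratr q| < k.+1%:R^-1.
    move=> ij.
    have : X w ij.1 ij.2 - k.+1%:R^-1 < X w ij.1 ij.2 + k.+1%:R^-1.
      by rewrite ltrD2l gtrN.
    move=> /rat_in_itvoo[q0]; rewrite in_itv/= => q01.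
    by exists q0; rewrite distrC ltr_distl.
  exists (\matrix_(i, j) c (i, j), k) => /=; last first.
    by move=> i j; rewrite mxE; exact: (cP (i, j)).
  move=> x /= xc; apply: rU; split => // i j.
  rewrite /ball/= -(subrKA (ratr (c (i, j)))).
  apply: le_lt_trans (ler_normD _ _) _; apply: lt_trans kr.
  rewrite mulr_natl mulr2n ltrD//; first exact: (cP (i, j)).
  by rewrite distrC; have := xc i j; rewrite /= mxE.
have -> : \bigcup_(c in [set c | B c `<=` U]) (X @^-1` B c) =
    \bigcup_k (if unpickle k is Some c then
                 if `[< B c `<=` U >] then X @^-1` B c else set0 else set0).
  apply/seteqP; split=> [w [c /= BU Bw]|w [k _]].
    by exists (pickle c) => //; rewrite pickleK asboolT.
  by case: unpickle => // c; case: asboolP => // BU Bw; exists c.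
apply: bigcupT_measurable => k; case: unpickle => // c; case: asboolP => // _.
have -> : X @^-1` B c = \bigcap_(i in [set: 'I_p]) \bigcap_(j in [set: 'I_q])
    [set w | `|X w i j - ratr (c.1 i j)| < c.2.+1%:R^-1].
  by apply/seteqP; split=> [w Bw i _ j _|w Bw i j]; [exact: Bw|exact: Bw].
apply: fin_bigcap_measurable => // i _; apply: fin_bigcap_measurable => // j _.
have -> : [set w | `|X w i j - ratr (c.1 i j)| < c.2.+1%:R^-1] =
    setT `&` (fun w => X w i j) @^-1` ball (ratr (c.1 i j) : R) c.2.+1%:R^-1.
  by rewrite setTI; apply/seteqP; split=> w; rewrite /ball/= distrC.
by apply: mX => //; exact: measurable_ball.
Qed.

(** Pointwise limits of Borel maps with values in a normed space are Borel,
    whether or not the space is separable. *)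
Lemma open_measurable_lim (M : normedModType R) (f_ : nat -> Omega -> M) (f : Omega -> M) :
  (forall n, open_measurable_map (f_ n)) ->
  (forall w, f_ n w @[n --> \oo] --> f w) -> open_measurable_map f.
Proof.
move=> mf ff U oU.
pose r (m : nat) : R := m.+1%:R^-1.
have r0 m : 0 < r m by rewrite invr_gt0.
(* [V m] is an open set of points that stay in [U] after a small move; the
   sets [V m] exhaust [U]. *)
pose V m : set M := \bigcup_(x in [set x | ball x (2 * r m) `<=` U]) ball x (r m).
have oV m : open (V m) by apply: bigcup_open => x _; exact: ball_open.
have -> : f @^-1` U = \bigcup_m \bigcup_N \bigcap_(n in [set n | (N <= n)%N]) (f_ n @^-1` V m).
  apply/seteqP; split=> [w /= Uw|w [m _ [N _ /= fV]]].
    have /nbhs_ballP[e /= e0 eU] : nbhs (f w) U by exact: open_nbhs_nbhs.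
    have [m /= me] : exists m, 2 * r m < e.
      have /archi_boundP : 0 <= 2 / e by rewrite divr_ge0// ltW.
      move=> em; exists (Num.bound (2 / e)).
      rewrite /r ltr_pdivrMr// mulrC -ltr_pdivrMr//.
      by apply: lt_trans em _; rewrite ltr_nat.
    have /cvg_ballP/(_ _ (r0 m))[N _ NV] := ff w.
    exists m => //; exists N => // n /= Nn; exists (f w); last exact: NV.
    by move=> x /= xb; apply: eU; exact: le_ball (ltW me) _ xb.
  have /cvg_ballP/(_ _ (r0 m))[N' _ N'V] := ff w.
  have [x /= xU xf] := fV (maxn N N') (leq_maxl _ _).
  apply: xU; rewrite mulr_natl mulr2n; apply: ball_triangle xf _; apply: ball_sym.
  exact: N'V (leq_maxr _ _).
apply: bigcupT_measurable => m; apply: bigcupT_measurable => N.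
apply: bigcap_measurable => [|n _]; first by exists N => /=.
exact: mf.
Qed.

End borel_measurability.

(** * Dyadic refinement of Riemann sums *)

Section dyadic_sums.

Lemma big_double (V : nmodType) (F : nat -> V) N :
  \sum_(k < N.*2) F k = \sum_(k < N) (F k.*2 + F k.*2.+1).
Proof.
elim: N => [|N IH]; first by rewrite !big_ord0.
by rewrite doubleS !big_ord_recr/= IH addrA.
Qed.

Lemma expn2S n : (2 ^ n.+1)%N = (2 ^ n).*2.
Proof. by rewrite expnS mul2n. Qed.

(** Summation by parts along the dyadic tree: if [g] is inherited by left
    children and [B] is additive, then passing from level [m] to level [m.+1]
    changes the sum only through the right children. *)
Lemma dyadic_refinement (R : pzRingType) (g B : nat -> nat -> R) m :
  (forall l, g m.+1 l.*2 = g m l) ->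
  (forall l, B m l = B m.+1 l.*2 + B m.+1 l.*2.+1) ->
  \sum_(k < 2 ^ m.+1) g m.+1 k * B m.+1 k =
  \sum_(k < 2 ^ m) g m k * B m k +
  \sum_(k < 2 ^ m) (g m.+1 k.*2.+1 - g m k) * B m.+1 k.*2.+1.
Proof.
move=> gE BE; rewrite expn2S (big_double (fun k => g m.+1 k * B m.+1 k)).
rewrite -big_split/=; apply: eq_bigr => k _.
by rewrite gE BE mulrDr mulrBl addrA addrAC addrK addrC.
Qed.

Lemma dyadic_chaining (R : pzRingType) (g B : nat -> nat -> R) n :
  (forall m l, g m.+1 l.*2 = g m l) ->
  (forall m l, (m < n)%N -> B m l = B m.+1 l.*2 + B m.+1 l.*2.+1) ->
  \sum_(k < 2 ^ n) g n k * B n k = g 0%N 0%N * B 0%N 0%N +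
  \sum_(m < n) \sum_(k < 2 ^ m) (g m.+1 k.*2.+1 - g m k) * B m.+1 k.*2.+1.
Proof.
move=> gE; elim: n => [|n IH] BE; first by rewrite big_ord1 big_ord0 addr0.
rewrite dyadic_refinement// => [|l]; last exact: BE.
by rewrite IH => [|m l mn]; [rewrite big_ord_recr/= addrA|exact/BE/ltnW].
Qed.

End dyadic_sums.

Section dyadic_path.
Context {R : realType} {d : nat} (e : R).
Hypotheses (e0 : 0 < e) (e1 : e < 1).
(** A path sampled at dyadic times: [w n k] is its value at time k / 2^n. *)
Variable w : nat -> nat -> 'rV[R]_d.+1.
Hypothesis wE : forall n k, w n.+1 k.*2 = w n k.
Implicit Types f : C1e d e.

(** The left-point Riemann sum of level [n] of [f] along the path. *)
Definition riemann_sum (f : 'rV[R]_d.+1 -> 'rV[R]_d.+1) n : R :=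
  \sum_(k < 2 ^ n) dotrv (f (w n k)) (w n k.+1 - w n k).

(** First and second half of the increment over the k-th interval of level n. *)
Definition half1 n k : 'rV[R]_d.+1 := w n.+1 k.*2.+1 - w n k.
Definition half2 n k : 'rV[R]_d.+1 := w n.+1 k.*2.+2 - w n.+1 k.*2.+1.

(** The sum of the products of the halves over the intervals of level [n] that
    are contained in the l-th interval of level [m]. *)
Definition block n i j m l : R :=
  \sum_(k < 2 ^ (n - m)) half1 n (l * 2 ^ (n - m) + k) ord0 i *
                         half2 n (l * 2 ^ (n - m) + k) ord0 j.

Lemma block_leaf n i j l : block n i j n l = half1 n l ord0 i * half2 n l ord0 j.
Proof. by rewrite /block subnn big_ord1 muln1 addn0. Qed.

Lemma block_split n i j m l : (m < n)%N ->
  block n i j m l = block n i j m.+1 l.*2 + block n i j m.+1 l.*2.+1.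
Proof.
move=> mn; rewrite /block; have -> : (n - m)%N = (n - m.+1).+1 by lia.
set N := (2 ^ (n - m.+1))%N.
have -> : (2 ^ (n - m.+1).+1)%N = (N + N)%N by rewrite expn2S addnn.
rewrite big_split_ord/=; congr (_ + _); apply: eq_bigr => k _.
  by have -> : (l * (N + N) + k = l.*2 * N + k)%N by lia.
by have -> : (l * (N + N) + (N + k) = l.*2.+1 * N + k)%N by lia.
Qed.

(** Only the second halves of the intervals contribute to a refinement. *)
Lemma riemann_sumS f n : riemann_sum f n.+1 - riemann_sum f n =
  \sum_i \sum_(k < 2 ^ n)
    (f (w n.+1 k.*2.+1) ord0 i - f (w n k) ord0 i) * half2 n k ord0 i.
Proof.
have riemannE m : riemann_sum f m =
    \sum_i \sum_(k < 2 ^ m) f (w m k) ord0 i * (w m k.+1 - w m k) ord0 i.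
  by rewrite /riemann_sum exchange_big.
rewrite !riemannE -sumrB; apply: eq_bigr => i _.
rewrite (dyadic_refinement (g := fun m k => f (w m k) ord0 i)
  (B := fun m k => (w m k.+1 - w m k) ord0 i)).
- by rewrite addrC addKr.
- by move=> l; rewrite wE.
- by move=> l; rewrite -doubleS !wE !mxE; ring.
Qed.

(** First-order expansion of a refinement; the linear part is kept as it is,
    because its size comes from cancellations. *)
Lemma riemann_sumS_taylor f n : `|riemann_sum f n.+1 - riemann_sum f n| <=
  `|f| * (\sum_(k < 2 ^ n) l1norm (half1 n k) `^ e * l1norm (half1 n k) *
              l1norm (half2 n k)) +
  \sum_i \sum_j `|\sum_(k < 2 ^ n) 'J f (w n k) i j *
                    (half1 n k ord0 i * half2 n k ord0 j)|.
Proof.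
rewrite riemann_sumS.
pose rem k j := f (w n.+1 k.*2.+1) ord0 j - f (w n k) ord0 j -
                \sum_i half1 n k ord0 i * 'J f (w n k) i j.
have remP k j : `|rem k j| <= `|f| * (l1norm (half1 n k) `^ e * l1norm (half1 n k)).
  have := C1e_taylor f (w n k) (half1 n k) j (ltW e0).
  by rewrite (_ : w n k + half1 n k = w n.+1 k.*2.+1)// /half1 addrC subrK.
have -> : \sum_j \sum_(k < 2 ^ n)
    (f (w n.+1 k.*2.+1) ord0 j - f (w n k) ord0 j) * half2 n k ord0 j =
  (\sum_j \sum_(k < 2 ^ n) rem k j * half2 n k ord0 j) +
  \sum_i \sum_j \sum_(k < 2 ^ n) 'J f (w n k) i j *
                    (half1 n k ord0 i * half2 n k ord0 j).
  rewrite [X in _ + X]exchange_big/= -big_split/=; apply: eq_bigr => j _.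
  rewrite exchange_big/= -big_split/=; apply: eq_bigr => k _.
  rewrite /rem [in RHS]mulrBl mulr_suml -addrA [X in _ = _ + X]addrC -sumrB.
  by rewrite big1 ?addr0// => i _; rewrite mulrCA mulrA subrr.
apply: le_trans (ler_normD _ _) _; apply: lerD.
  rewrite exchange_big/= mulr_sumr.
  apply: le_trans (ler_norm_sum _ _ _) _; apply: ler_sum => k _.
  apply: le_trans (ler_norm_sum _ _ _) _.
  rewrite mulrA [X in _ <= _ * X]/l1norm mulr_sumr; apply: ler_sum => j _.
  by rewrite normrM ler_wpM2r.
apply: le_trans (ler_norm_sum _ _ _) _; apply: ler_sum => i _.
exact: ler_norm_sum.
Qed.

(** Summation by parts separates the test function, which enters only through
    its norm, from the sums over blocks. *)
Lemma jacobian_sum_bound f n i j :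
  `|\sum_(k < 2 ^ n) 'J f (w n k) i j * (half1 n k ord0 i * half2 n k ord0 j)| <=
  `|f| * (`|block n i j 0 0| +
          \sum_(m < n) \sum_(l < 2 ^ m)
             l1norm (half1 m l) `^ e * `|block n i j m.+1 l.*2.+1|).
Proof.
under eq_bigr do rewrite -block_leaf.
rewrite (dyadic_chaining (g := fun m k => 'J f (w m k) i j) (B := block n i j)).
- rewrite mulrDr; apply: le_trans (ler_normD _ _) _; apply: lerD.
    by rewrite normrM ler_wpM2r// C1e_jacobian_bound.
  rewrite mulr_sumr; apply: le_trans (ler_norm_sum _ _ _) _; apply: ler_sum => m _.
  rewrite mulr_sumr; apply: le_trans (ler_norm_sum _ _ _) _; apply: ler_sum => l _.
  rewrite normrM mulrA ler_wpM2r//.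
  exact: C1e_jacobian_holder (ltW e0).
- by move=> m l; rewrite wE.
- by move=> m l; exact: block_split.
Qed.

(** Scales: a Brownian increment over an interval of level m has order
    [rho ^+ m], and its e-th power has order [rate ^+ m]. *)
Definition rho : R := (Num.sqrt 2)^-1.
Definition rate : R := rho `^ e.

Lemma rho_gt0 : 0 < rho. Proof. by rewrite invr_gt0 sqrtr_gt0. Qed.
Lemma rho_sqr n : (rho ^+ n) ^+ 2 = (2 ^+ n)^-1.
Proof. by rewrite -exprM mulnC exprM /rho exprVn sqr_sqrtr// exprVn. Qed.
Lemma rho_lt1 : rho < 1.
Proof. by rewrite -(@ltr_pXn2r _ 2)// ?nnegrE ?ltW ?rho_gt0// -[rho]expr1 rho_sqr; lra. Qed.
Lemma rate_gt0 : 0 < rate. Proof. exact/powR_gt0/rho_gt0. Qed.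
Let powR1E (p : R) : 1 `^ p = 1. Proof. by rewrite powR1. Qed.

Lemma rate_lt1 : rate < 1.
Proof.
rewrite -[ltRHS](powR1E e) /rate.
by apply: gt0_ltr_powR; rewrite ?nnegrE ?(ltW rho_gt0)// rho_lt1.
Qed.

Lemma rho_lt_rate : rho < rate.
Proof.
have r0 := ltW rho_gt0.
have -> : rho = rate * rho `^ (1 - e).
  rewrite /rate -powRD; last by rewrite (lt0r_neq0 rho_gt0) implybT.
  by rewrite addrC subrK powRr1.
rewrite gtr_pMr ?rate_gt0// -[ltRHS](powR1E (1 - e)).
by apply: gt0_ltr_powR; rewrite ?subr_gt0 ?nnegrE ?rho_lt1.
Qed.

Let powR_le1Dsqr (t p : R) : 0 <= t -> 0 <= p <= 2 -> t `^ p <= 1 + t ^+ 2.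
Proof.
move=> t0 /andP[p0 p2]; have [t1|/ltW t1] := leP t 1.
  apply: (@le_trans _ _ 1); last by rewrite lerDl sqr_ge0.
  by rewrite -[leRHS](powR1E p); apply: ge0_ler_powR; rewrite ?nnegrE.
apply: (@le_trans _ _ (t ^+ 2)); last by rewrite lerDr.
by rewrite -powR_mulrn//; exact: ler_powR.
Qed.

Let powRX (x p : R) m : 0 <= x -> (x ^+ m) `^ p = (x `^ p) ^+ m.
Proof.
move=> x0; rewrite -(powR_mulrn m x0) -(powR_mulrn m (powR_ge0 x p)).
by rewrite -!powRrM mulrC.
Qed.

(* A power at most 2 of a quantity of order [rho ^+ m] is controlled by its
   square. *)
Let powR_scale (u p : R) m : 0 <= u -> 0 <= p <= 2 ->
  u `^ p <= (rho `^ p) ^+ m * (1 + 2 ^+ m * u ^+ 2).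
Proof.
move=> u0 p02; have r0 : 0 < rho ^+ m by rewrite exprn_gt0// rho_gt0.
pose t := u / rho ^+ m; have t0 : 0 <= t by rewrite divr_ge0// ltW.
have -> : 2 ^+ m * u ^+ 2 = t ^+ 2 by rewrite exprMn exprVn rho_sqr invrK mulrC.
have -> : u = rho ^+ m * t by rewrite mulrC divfK// gt_eqF.
rewrite powRM ?(ltW r0)// powRX ?(ltW rho_gt0)//.
by rewrite ler_wpM2l ?exprn_ge0 ?powR_ge0// powR_le1Dsqr.
Qed.

(** A polynomial in the increments that controls one refinement of the Riemann
    sums, uniformly over the unit ball of C^{1+e}. *)
Definition refinement_bound n : R :=
  rate ^+ n * (2 ^+ n)^-1 *
    (\sum_(k < 2 ^ n) (1 + 2 ^+ n * l1norm (half1 n k) ^+ 2) *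
                      (1 + 2 ^+ n * l1norm (half2 n k) ^+ 2)) +
  \sum_i \sum_j (rho ^+ n * (1 + 2 ^+ n * block n i j 0 0 ^+ 2) +
    \sum_(m < n) \sum_(l < 2 ^ m) rate ^+ m * rho ^+ (n + m) *
      (1 + 2 ^+ m * l1norm (half1 m l) ^+ 2 +
       2 * (2 ^+ (n + m) * block n i j m.+1 l.*2.+1 ^+ 2))).

Lemma riemann_sum_refinement f n :
  `|riemann_sum f n.+1 - riemann_sum f n| <= `|f| * refinement_bound n.
Proof.
have r0 := rho_gt0; have r1 : rho `^ 1 = rho by rewrite powRr1// ltW.
apply: le_trans (riemann_sumS_taylor f n) _; rewrite mulrDr; apply: lerD.
  rewrite ler_wpM2l// mulr_sumr; apply: ler_sum => k _.
  set u := l1norm (half1 n k); set v := l1norm (half2 n k).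
  have u0 : 0 <= u by exact: l1norm_ge0.
  have v0 : 0 <= v by exact: l1norm_ge0.
  have -> : u `^ e * u = u `^ (e + 1).
    by rewrite powRD ?powRr1// (_ : (e + 1 == 0) = false)// gt_eqF// addr_gt0.
  have e12 : 0 <= e + 1 <= 2 by move: e0 e1 => ? ?; apply/andP; split; lra.
  have l12 : 0 <= (1 : R) <= 2 by rewrite ler01 ler1n.
  have := powR_scale n v0 l12; rewrite r1 powRr1// => vle.
  have := powR_scale n u0 e12.
  rewrite [rho `^ _]powRD; last by rewrite (lt0r_neq0 r0) implybT.
  rewrite -/rate r1 => ule.
  apply: (@le_trans _ _ ((rate * rho) ^+ n * (1 + 2 ^+ n * u ^+ 2) *
                         (rho ^+ n * (1 + 2 ^+ n * v ^+ 2)))).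
    by apply: ler_pM => //; exact: powR_ge0.
  rewrite -rho_sqr le_eqVlt; apply/orP; left; apply/eqP.
  by rewrite exprMn; ring.
rewrite mulr_sumr; apply: ler_sum => i _; rewrite mulr_sumr; apply: ler_sum => j _.
apply: le_trans (jacobian_sum_bound f n i j) _; rewrite ler_wpM2l//; apply: lerD.
  have l12 : 0 <= (1 : R) <= 2 by rewrite ler01 ler1n.
  have := powR_scale n (normr_ge0 (block n i j 0 0)) l12.
  by rewrite r1 powRr1// real_normK ?num_real.
apply: ler_sum => m _; apply: ler_sum => l _.
set u := l1norm (half1 m l); set b := block n i j m.+1 l.*2.+1.
have u0 : 0 <= u by exact: l1norm_ge0.
have rm : 0 < rho ^+ m by exact: exprn_gt0.
have rnm : 0 < rho ^+ (n + m) by exact: exprn_gt0.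
pose t := u / rho ^+ m; pose s := `|b| / rho ^+ (n + m).
have t0 : 0 <= t by rewrite divr_ge0// ltW.
have s0 : 0 <= s by rewrite divr_ge0// ltW.
have t2 : 2 ^+ m * u ^+ 2 = t ^+ 2 by rewrite /t exprMn exprVn rho_sqr invrK mulrC.
have s2 : 2 ^+ (n + m) * b ^+ 2 = s ^+ 2.
  by rewrite /s exprMn exprVn rho_sqr invrK mulrC real_normK ?num_real.
have uE : u `^ e = rate ^+ m * t `^ e.
  rewrite -[in LHS](@divfK _ (rho ^+ m) _ u) ?gt_eqF// mulrC powRM ?(ltW rm)//.
  by rewrite powRX// ltW.
have bE : `|b| = rho ^+ (n + m) * s by rewrite mulrC divfK// gt_eqF.
rewrite t2 s2 uE bE mulrACA ler_wpM2l ?mulr_ge0 ?(ltW rnm)//.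
  by rewrite exprn_ge0// ltW// rate_gt0.
(* t^e <= 1 + t, then Young's inequality *)
have te : t `^ e <= 1 + t.
  have [t1|/ltW t1] := leP t 1.
    apply: (@le_trans _ _ 1); last by rewrite lerDl.
    by rewrite -[leRHS](powR1E e); apply: ge0_ler_powR; rewrite ?nnegrE// ltW.
  by apply: (@le_trans _ _ t); [exact: ler1_powR t1 (ltW e1)|rewrite lerDr].
apply: (@le_trans _ _ ((1 + t) * s)); first by rewrite ler_wpM2r.
have := sqr_ge0 (t - s); have := sqr_ge0 (1 - s); nra.
Qed.

Lemma dotrv_l1norm f (x y : 'rV[R]_d.+1) : `|dotrv (f x) y| <= `|f| * l1norm y.
Proof.
rewrite /dotrv /l1norm mulr_sumr; apply: le_trans (ler_norm_sum _ _ _) _.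
by apply: ler_sum => i _; rewrite normrM ler_wpM2r// C1e_bound.
Qed.

End dyadic_path.

(** * Mean size of one dyadic refinement *)

Section mean_bounds.
Context d (Omega : measurableType d) (R : realType) (P : probability Omega R).
Implicit Types X Y : Omega -> R.

(** [X] is a nonnegative random variable of mean at most [c]. *)
Definition mean_le X (c : R) : Prop :=
  [/\ measurable_fun setT X, forall w, 0 <= X w &
      (\int[P]_w (X w)%:E <= c%:E)%E].

Lemma mean_le_cst (c : R) : 0 <= c -> mean_le (fun=> c) c.
Proof.
move=> c0; split => //; rewrite integral_cst//.
by rewrite [X in (_ * X)%E]probability_setT mule1.
Qed.

Lemma mean_leW X c c' : c <= c' -> mean_le X c -> mean_le X c'.
Proof. by move=> cc' [? ? Xc]; split => //; apply: le_trans Xc _; rewrite lee_fin. Qed.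

Lemma mean_leD X Y a b : mean_le X a -> mean_le Y b ->
  mean_le (fun w => X w + Y w) (a + b).
Proof.
move=> [mX X0 Xa] [mY Y0 Yb]; split.
- exact: measurable_funD.
- by move=> w; exact: addr_ge0.
under eq_integral do rewrite EFinD.
rewrite ge0_integralD//; last 4 first.
- by move=> w _; rewrite lee_fin.
- exact/measurable_EFinP.
- by move=> w _; rewrite lee_fin.
- exact/measurable_EFinP.
by rewrite EFinD leeD.
Qed.

Lemma mean_leZ X k c : 0 <= k -> mean_le X c -> mean_le (fun w => k * X w) (k * c).
Proof.
move=> k0 [mX X0 Xc]; split.
- exact: measurable_funM.
- by move=> w; exact: mulr_ge0.
under eq_integral do rewrite EFinM.
rewrite ge0_integralZl//; last 2 first.
- exact/measurable_EFinP.
- by move=> w _; rewrite lee_fin.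
by rewrite EFinM lee_wpmul2l.
Qed.

Lemma mean_le_sum (I : Type) (r : seq I) (X : I -> Omega -> R) (c : I -> R) :
  (forall i, mean_le (X i) (c i)) ->
  mean_le (fun w => \sum_(i <- r) X i w) (\sum_(i <- r) c i).
Proof.
move=> Xc; elim: r => [|i r IH].
  rewrite big_nil; under eq_fun do rewrite big_nil; exact: mean_le_cst.
by rewrite big_cons; under eq_fun do rewrite big_cons; exact: mean_leD.
Qed.

Lemma mean_le_ord n (X : nat -> Omega -> R) (c : nat -> R) :
  (forall i, (i < n)%N -> mean_le (X i) (c i)) ->
  mean_le (fun w => \sum_(i < n) X i w) (\sum_(i < n) c i).
Proof. by move=> Xc; apply: mean_le_sum => i; exact: Xc. Qed.

Lemma le_mean X Y c : measurable_fun setT X -> (forall w, 0 <= X w <= Y w) ->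
  mean_le Y c -> mean_le X c.
Proof.
move=> mX XY [mY Y0 Yc]; split => //; first by move=> w; case/andP: (XY w).
apply: le_trans Yc; apply: ge0_le_integral => //.
- by move=> w _; rewrite lee_fin; case/andP: (XY w).
- exact/measurable_EFinP.
- exact/measurable_EFinP.
- by move=> w _; rewrite lee_fin; case/andP: (XY w).
Qed.

End mean_bounds.

Lemma sumr_ord_const (R : pzRingType) n (c : R) : \sum_(k < n) c = n%:R * c.
Proof. by rewrite sumr_const card_ord mulr_natl. Qed.

Lemma sqr_sum_norm_le (R : realType) n (v : 'I_n -> R) :
  (\sum_i `|v i|) ^+ 2 <= n%:R * \sum_i v i ^+ 2.
Proof.
have -> : n%:R * \sum_i v i ^+ 2 =
    \sum_(i < n) \sum_(j < n) ((v i ^+ 2 + v j ^+ 2) / 2).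
  transitivity (\sum_(i < n) (n%:R * (v i ^+ 2 / 2) +
                              (\sum_j v j ^+ 2) / 2)).
    rewrite big_split/= sumr_const card_ord -mulr_sumr -mulr_suml.
    by rewrite -[X in _ = _ + X]mulr_natl -mulrDr -splitr.
  apply: eq_bigr => i _; rewrite -mulr_suml big_split/= sumr_const card_ord.
  by rewrite mulrDl mulrA mulr_natl.
rewrite expr2 mulr_suml; apply: ler_sum => i _; rewrite mulr_sumr.
apply: ler_sum => j _.
rewrite -(real_normK (num_real (v i))) -(real_normK (num_real (v j))).
rewrite ler_pdivlMr//.
by have := sqr_ge0 (`|v i| - `|v j|); lra.
Qed.

Lemma l1norm_sqr (R : realType) n (v : 'rV[R]_n) :
  l1norm v ^+ 2 <= n%:R * \sum_i v ord0 i ^+ 2.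
Proof. exact: sqr_sum_norm_le. Qed.

Section brownian_refinement.
Context dis (Omega : measurableType dis) (R : realType) (P : probability Omega R).
Variables (d : nat) (W : R -> Omega -> 'rV[R]_d.+1).
Hypothesis hW : brownian_motion P W.
Variable T : R.
Hypothesis T0 : 0 < T.
Variable e : R.
Hypotheses (e0 : 0 < e) (e1 : e < 1).

(** The k-th dyadic time of level n in [0, T], and the path sampled there. *)
Definition dyad n k : R := T * k%:R / 2 ^+ n.
Definition sample (w : Omega) n k := W (dyad n k) w.

Lemma dyad_double n k : dyad n.+1 k.*2 = dyad n k.
Proof.
rewrite /dyad -mul2n natrM exprS; field.
by rewrite expf_neq0.
Qed.

Lemma sample_double w n k : sample w n.+1 k.*2 = sample w n k.
Proof. by rewrite /sample dyad_double. Qed.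

Lemma dyad_ge0 n k : 0 <= dyad n k.
Proof. by rewrite /dyad !mulr_ge0 ?(ltW T0)// invr_ge0 exprn_ge0. Qed.

Lemma dyad_le n k l : (k <= l)%N -> dyad n k <= dyad n l.
Proof.
move=> kl; rewrite /dyad ler_wpM2r ?invr_ge0 ?exprn_ge0//.
by rewrite ler_wpM2l ?(ltW T0)// ler_nat.
Qed.

Lemma dyadS n k : dyad n k.+1 - dyad n k = T / 2 ^+ n.
Proof. by rewrite /dyad -mulrBl -mulrBr -natr1 addrC addKr mulr1. Qed.

Lemma dyad_ltS n k : dyad n k < dyad n k.+1.
Proof. by rewrite -subr_gt0 dyadS divr_gt0// exprn_gt0. Qed.

Lemma dyad_max n : dyad n (2 ^ n) = T.
Proof. by rewrite /dyad natrX mulfK// expf_neq0. Qed.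

Let half1E n k i w : half1 (sample w) n k ord0 i =
  increment W (dyad n.+1 k.*2) (dyad n.+1 k.*2.+1) i w.
Proof. by rewrite /half1 -(sample_double w n k). Qed.

Let step n : 8 * (T / 2 ^+ n.+1) = 4 * T / 2 ^+ n.
Proof. by rewrite exprS; field; rewrite expf_neq0. Qed.

Lemma half1_coord_adapted n k i :
  adapted W (dyad n.+1 k.*2.+1) (fun w => half1 (sample w) n k ord0 i).
Proof.
under eq_fun do rewrite half1E.
by apply: adapted_increment; rewrite ?dyad_ge0 ?dyad_le.
Qed.

Lemma half1_adapted n k :
  adapted W (dyad n.+1 k.*2.+1) (fun w => l1norm (half1 (sample w) n k)).
Proof.
apply: measurable_sum => i; apply: measurableT_comp => //.
exact: half1_coord_adapted.
Qed.

Lemma half1_coord_mean n k i :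
  mean_le P (fun w => half1 (sample w) n k ord0 i ^+ 2) (4 * T / 2 ^+ n).
Proof.
split.
- apply: measurable_funX; apply: (adapted_measurable hW).
  exact: half1_coord_adapted.
- by move=> w; exact: sqr_ge0.
under eq_integral do rewrite half1E.
rewrite -step -(dyadS _ k.*2); apply: (increment_second_moment hW) => //.
  exact: dyad_ge0.
exact: dyad_ltS.
Qed.

Lemma half2_coord_measurable n k i :
  measurable_fun setT (fun w => half2 (sample w) n k ord0 i).
Proof. by apply: (measurable_increment hW); exact: dyad_ge0. Qed.

Lemma half2_coord_mean n k i :
  mean_le P (fun w => half2 (sample w) n k ord0 i ^+ 2) (4 * T / 2 ^+ n).
Proof.
split.
- by apply: measurable_funX; exact: half2_coord_measurable.
- by move=> w; exact: sqr_ge0.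
rewrite -step -(dyadS _ k.*2.+1); apply: (increment_second_moment hW) => //.
  exact: dyad_ge0.
exact: dyad_ltS.
Qed.

Let D : R := d.+1%:R.
Let c1 := 4 * D ^+ 2 * T.
Let c2 := 16 * T ^+ 2.

Let c1_ge0 : 0 <= c1.
Proof. by rewrite /c1 !mulr_ge0 ?exprn_ge0 ?(ltW T0) ?ler0n. Qed.
Let c2_ge0 : 0 <= c2. Proof. by rewrite /c2 mulr_ge0 ?sqr_ge0. Qed.

Lemma half1_mean n k :
  mean_le P (fun w => 2 ^+ n * l1norm (half1 (sample w) n k) ^+ 2) c1.
Proof.
have H := @mean_le_sum _ _ _ P _ (index_enum 'I_d.+1) _ _ (half1_coord_mean n k).
have D0 : 0 <= D by exact: ler0n.
have mX : measurable_fun setT (fun w => 2 ^+ n * l1norm (half1 (sample w) n k) ^+ 2).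
  apply: measurable_funM => //; apply: measurable_funX.
  exact: (adapted_measurable hW (@half1_adapted n k)).
have XY w : 0 <= 2 ^+ n * l1norm (half1 (sample w) n k) ^+ 2 <=
    2 ^+ n * (D * \sum_i half1 (sample w) n k ord0 i ^+ 2).
  rewrite mulr_ge0 ?exprn_ge0 ?l1norm_ge0//=.
  by rewrite ler_wpM2l ?exprn_ge0// l1norm_sqr.
apply: mean_leW (le_mean mX XY (mean_leZ (exprn_ge0 n (ler0n R 2)) (mean_leZ D0 H))).
rewrite sumr_ord_const -/D /c1 le_eqVlt; apply/orP; left; apply/eqP.
by field; rewrite expf_neq0.
Qed.

Lemma halves_mean n k :
  mean_le P (fun w => (1 + 2 ^+ n * l1norm (half1 (sample w) n k) ^+ 2) *
                      (1 + 2 ^+ n * l1norm (half2 (sample w) n k) ^+ 2))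
    ((1 + c1) ^+ 2).
Proof.
have p0 : 0 <= 2 ^+ n :> R by exact: exprn_ge0.
pose u w := l1norm (half1 (sample w) n k).
pose v j w := half2 (sample w) n k ord0 j.
have au := @half1_adapted n k; have mu := adapted_measurable hW au.
have H1 : mean_le P (fun w => 1 + 2 ^+ n * u w ^+ 2) (1 + c1).
  by apply: mean_leD; [exact: mean_le_cst|exact: half1_mean].
have uv j : mean_le P (fun w => 2 ^+ n * (u w * v j w) ^+ 2) (c1 * (4 * T / 2 ^+ n)).
  have [_ _ u2] := half1_mean n k; have [_ _ v2] := half2_coord_mean n k j.
  split.
  - apply: measurable_funM => //; apply: measurable_funX; apply: measurable_funM => //.
    exact: half2_coord_measurable.
  - by move=> w; rewrite mulr_ge0 ?sqr_ge0.
  under eq_integral do rewrite EFinM.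
  rewrite ge0_integralZl//; last 2 first.
  - apply/measurable_EFinP; apply: measurable_funX; apply: measurable_funM => //.
    exact: half2_coord_measurable.
  - by move=> w _; rewrite lee_fin sqr_ge0.
  rewrite [X in (_ * X)%E](second_moment_adaptedM hW j (dyad_ge0 _ _) (dyad_ltS _ _) au).
  rewrite muleA EFinM; apply: lee_pmul => //.
  - by rewrite mule_ge0// ?lee_fin//; apply: integral_ge0 => w _; rewrite lee_fin sqr_ge0.
  - by apply: integral_ge0 => w _; rewrite lee_fin sqr_ge0.
  rewrite -ge0_integralZl//.
  - by apply/measurable_EFinP; apply: measurable_funX.
  - by move=> w _; rewrite lee_fin sqr_ge0.
have H2 := mean_leZ p0 (mean_leZ (ler0n R d.+1) (@mean_le_sum _ _ _ P _ (index_enum 'I_d.+1) _ _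
  (fun j => mean_leD (half2_coord_mean n k j) (uv j)))).
have mX : measurable_fun setT (fun w => (1 + 2 ^+ n * u w ^+ 2) *
    (1 + 2 ^+ n * l1norm (half2 (sample w) n k) ^+ 2)).
  apply: measurable_funM; apply: measurable_funD => //; apply: measurable_funM => //.
    exact: measurable_funX.
  apply: measurable_funX; apply: measurable_sum => j; apply: measurableT_comp => //.
  exact: half2_coord_measurable.
apply: mean_leW (le_mean mX _ (mean_leD H1 H2)).
  rewrite sumr_ord_const -/D le_eqVlt.
  apply/orP; left; apply/eqP.
  by rewrite /c1; field; rewrite expf_neq0.
have ge0 (a : R) : 0 <= 1 + 2 ^+ n * a ^+ 2.
  exact: addr_ge0 ler01 (mulr_ge0 p0 (sqr_ge0 _)).
move=> w; rewrite (mulr_ge0 (ge0 _) (ge0 _))/=.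
have := l1norm_sqr (half2 (sample w) n k).
set V := l1norm _ ^+ 2; set S := \sum_i _ => VS.
have -> : \sum_i (half2 (sample w) n k ord0 i ^+ 2 + 2 ^+ n * (u w * v i w) ^+ 2) =
    S + 2 ^+ n * u w ^+ 2 * S.
  rewrite big_split/=; congr (_ + _); rewrite mulr_sumr.
  by apply: eq_bigr => i _; rewrite exprMn mulrA.
have -> : 1 + 2 ^+ n * u w ^+ 2 +
  2 ^+ n * (d.+1%:R * (S + 2 ^+ n * u w ^+ 2 * S)) =
  (1 + 2 ^+ n * u w ^+ 2) * (1 + 2 ^+ n * (d.+1%:R * S)) by ring.
apply: ler_wpM2l; first exact: ge0.
by rewrite lerD2l ler_wpM2l.
Qed.

(** The terms of a block are orthogonal, so its mean square is the number of
    terms times the mean square of one term. *)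
Lemma block_mean n i j m l : (m <= n)%N ->
  mean_le P (fun w => 2 ^+ (n + m) * block (sample w) n i j m l ^+ 2) c2.
Proof.
move=> mn; set N := (2 ^ (n - m))%N.
pose s k := dyad n.+1 (l * N + k).*2.+1.
pose t k := dyad n.+1 (l * N + k).*2.+2.
have blockE w : block (sample w) n i j m l =
   \sum_(k < N) half1 (sample w) n (l * N + k) ord0 i * increment W (s k) (t k) j w.
  by [].
have mb : measurable_fun setT (fun w => block (sample w) n i j m l).
  apply: measurable_sum => k; apply: measurable_funM.
    exact: (adapted_measurable hW (@half1_coord_adapted _ _ _)).
  exact: half2_coord_measurable.
split.
- by apply: measurable_funM => //; exact: measurable_funX.
- by move=> w; rewrite mulr_ge0 ?sqr_ge0 ?exprn_ge0.
under eq_integral do rewrite EFinM.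
rewrite ge0_integralZl//; last 2 first.
- by apply/measurable_EFinP; exact: measurable_funX.
- by move=> w _; rewrite lee_fin sqr_ge0.
apply: (@le_trans _ _ ((2 ^+ (n + m))%:E *
    (\sum_(k < N) (4 * T / 2 ^+ n) * (8 * (t k - s k)))%:E)%E).
  rewrite lee_wpmul2l ?lee_fin ?exprn_ge0//.
  apply: (transform_second_moment hW (s := s) (t := t) (a := fun=> 4 * T / 2 ^+ n)
    (X := fun k w => half1 (sample w) n (l * N + k) ord0 i)) => k.
  - exact: dyad_ge0.
  - exact: dyad_ltS.
  - by apply: dyad_le; rewrite addnS doubleS.
  - exact: half1_coord_adapted.
  - by case: (half1_coord_mean n (l * N + k) i).
under eq_bigr do rewrite dyadS step.
rewrite sumr_ord_const -EFinM lee_fin /N natrX.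
have -> : 2 ^+ (n + m) * (2 ^+ (n - m) * (4 * T / 2 ^+ n * (4 * T / 2 ^+ n))) =
   2 ^+ (n + m) * 2 ^+ (n - m) * (c2 / (2 ^+ n * 2 ^+ n)) :> R.
  by rewrite /c2; field; rewrite expf_neq0.
have -> : 2 ^+ (n + m) * 2 ^+ (n - m) = 2 ^+ n * 2 ^+ n :> R.
  by rewrite -!exprD; congr (_ ^+ _); lia.
by rewrite mulrC divfK// mulf_neq0 ?expf_neq0.
Qed.

(** The sum over the levels of the blocks is geometric with ratio
    [rate / rho > 1]; its last term dominates and has order [rate ^+ n]. This is
    where e < 1 matters. *)
Lemma refinement_bound_mean : exists2 C, 0 <= C & forall n,
  mean_le P (fun w => refinement_bound e (sample w) n) (C * rate e ^+ n).
Proof.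
have r0 := @rho_gt0 R; have q0 : 0 < rate e by exact: rate_gt0.
have rq : rho < rate e by exact: rho_lt_rate.
set x := rate e / (rho : R); have x1 : 1 < x by rewrite ltr_pdivlMr// mul1r.
pose c3 := 1 + c1 + 2 * c2.
have c3_ge0 : 0 <= c3.
  exact: addr_ge0 (addr_ge0 ler01 c1_ge0) (mulr_ge0 (ler0n _ 2) c2_ge0).
exists ((1 + c1) ^+ 2 + D ^+ 2 * ((1 + c2) + c3 / (x - 1))).
  apply: addr_ge0; first exact: sqr_ge0.
  apply: mulr_ge0; first exact: sqr_ge0.
  apply: addr_ge0; first exact: addr_ge0 ler01 c2_ge0.
  by apply: divr_ge0 => //; rewrite subr_ge0 ltW.
move=> n; set qn := rate e ^+ n; have qn0 : 0 <= qn by rewrite exprn_ge0// ltW.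
have p0 k : 0 < 2 ^+ k :> R by exact: exprn_gt0.
have M1 : mean_le P (fun w => qn * (2 ^+ n)^-1 *
    (\sum_(k < 2 ^ n) (1 + 2 ^+ n * l1norm (half1 (sample w) n k) ^+ 2) *
                      (1 + 2 ^+ n * l1norm (half2 (sample w) n k) ^+ 2)))
    ((1 + c1) ^+ 2 * qn).
  have H := @mean_le_ord _ _ _ P (2 ^ n) _ _ (fun k _ => halves_mean n k).
  have k0 : 0 <= qn * (2 ^+ n)^-1 by rewrite mulr_ge0// invr_ge0 ltW.
  apply: mean_leW (mean_leZ k0 H).
  rewrite sumr_ord_const natrX mulrA -(mulrA qn) mulVf ?gt_eqF//.
  by rewrite mulr1 mulrC.
have M2 i j : mean_le P (fun w => (rho : R) ^+ n * (1 + 2 ^+ n * block (sample w) n i j 0 0 ^+ 2))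
    ((1 + c2) * qn).
  have H := mean_leD (mean_le_cst P ler01) (@block_mean n i j 0 0 (leq0n n)).
  rewrite addn0 in H.
  apply: mean_leW (mean_leZ (exprn_ge0 n (ltW r0)) H).
  rewrite mulrC; apply: ler_wpM2l; first exact: addr_ge0 ler01 c2_ge0.
  by apply: lerXn2r; rewrite ?nnegrE ltW.
have M3 i j : mean_le P (fun w => \sum_(m < n) \sum_(l < 2 ^ m)
      rate e ^+ m * (rho : R) ^+ (n + m) *
      (1 + 2 ^+ m * l1norm (half1 (sample w) m l) ^+ 2 +
       2 * (2 ^+ (n + m) * block (sample w) n i j m.+1 l.*2.+1 ^+ 2)))
    (c3 / (x - 1) * qn).
  have H m : (m < n)%N -> mean_le P (fun w => \sum_(l < 2 ^ m)
      rate e ^+ m * (rho : R) ^+ (n + m) *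
      (1 + 2 ^+ m * l1norm (half1 (sample w) m l) ^+ 2 +
       2 * (2 ^+ (n + m) * block (sample w) n i j m.+1 l.*2.+1 ^+ 2)))
      (c3 * (rho : R) ^+ n * x ^+ m).
    move=> mn.
    have B l : mean_le P (fun w => 2 ^+ (n + m) * block (sample w) n i j m.+1 l ^+ 2) c2.
      have mb := block_mean i j l mn; case: (mb) => mB _ _.
      apply: le_mean mb.
        apply: eq_measurable_fun
          (measurable_funM (@measurable_cst _ _ _ _ setT (2^-1 : R)) mB) => w _ /=.
        by rewrite addnS exprS; field.
      move=> w; rewrite mulr_ge0 ?sqr_ge0 ?(ltW (p0 _))//=.
      apply: ler_wpM2r; first exact: sqr_ge0.
      by apply: ler_weXn2l; [rewrite ler1n|rewrite leq_add2l].
    have rr : 0 <= rate e ^+ m * (rho : R) ^+ (n + m).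
      by rewrite mulr_ge0 ?exprn_ge0 ?ltW.
    have G := @mean_le_ord _ _ _ P (2 ^ m) _ _ (fun l _ => mean_leZ rr
      (mean_leD (mean_leD (mean_le_cst P ler01) (half1_mean m l))
                (mean_leZ (ler0n R 2) (B l.*2.+1)))).
    apply: mean_leW G; rewrite sumr_ord_const -/c3 natrX.
    rewrite le_eqVlt; apply/orP; left; apply/eqP.
    (* rho ^ 2 = 1 / 2 *)
    have -> : x ^+ m = rate e ^+ m * (2 ^+ m * (rho : R) ^+ m).
      rewrite /x exprMn exprVn; congr (_ * _).
      have := @rho_sqr R m; rewrite expr2 => h.
      apply: (mulfI (lt0r_neq0 (exprn_gt0 m r0))).
      rewrite mulfV ?(lt0r_neq0 (exprn_gt0 m r0))// mulrCA h mulfV//.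
    by rewrite exprD; ring.
  apply: mean_leW (mean_le_ord H); rewrite -mulr_sumr.
  have xS : (\sum_(m < n) x ^+ m) = (x ^+ n - 1) / (x - 1).
    by rewrite subrX1 mulrC mulKf// subr_eq0 gt_eqF.
  have xr : (rho : R) ^+ n * x ^+ n = qn.
    by rewrite /x expr_div_n mulrC divfK// (lt0r_neq0 (exprn_gt0 n r0)).
  rewrite xS -!mulrA ler_wpM2l// mulrA (mulrC _ qn) ler_wpM2r ?invr_ge0 ?subr_ge0 ?(ltW x1)//.
  by rewrite mulrBr xr mulr1 gerBl exprn_ge0// ltW.
have M := mean_leD M1 (@mean_le_sum _ _ _ P _ (index_enum 'I_d.+1) _ _ (fun i =>
  @mean_le_sum _ _ _ P _ (index_enum 'I_d.+1) _ _ (fun j => mean_leD (M2 i j) (M3 i j)))).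
apply: mean_leW M.
rewrite !sumr_ord_const -/D le_eqVlt; apply/orP; left; apply/eqP.
by ring.
Qed.

End brownian_refinement.

(** * The Riemann sums as random elements of the dual space *)

Lemma cvg_sum_seq (R : numFieldType) (S : Type) (F : set_system S)
    {FF : Filter F} (M : normedModType R) (I : Type) (r : seq I)
    (f : I -> S -> M) (l : I -> M) :
  (forall i, f i s @[s --> F] --> l i) ->
  \sum_(i <- r) f i s @[s --> F] --> \sum_(i <- r) l i.
Proof.
move=> fl; elim: r => [|i r IH].
  by rewrite big_nil; under eq_fun do rewrite big_nil; exact: cvg_cst.
by rewrite big_cons; under eq_fun do rewrite big_cons; exact: cvgD.
Qed.

Section evaluation.
Context {R : realType} {d : nat} {e : R}.
Local Notation V := (C1e d e).
Implicit Types x y : 'rV[R]_d.+1.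

(* The next two lemmas go through generic matrix identities: a direct [mxE]
   would unfold the test functions. *)
Lemma C1e_coordD (f g : V) x i : (f + g) x ord0 i = f x ord0 i + g x ord0 i.
Proof.
have addE m n (A B : 'M[R]_(m, n)) k l : (A + B) k l = A k l + B k l by rewrite mxE.
exact: (addE _ _ (f x) (g x)).
Qed.

Lemma C1e_coordZ c (f : V) x i : (c *: f) x ord0 i = c * f x ord0 i.
Proof.
have scaleE m n (A : 'M[R]_(m, n)) k l : (c *: A) k l = c * A k l by rewrite mxE.
exact: (scaleE _ _ (f x)).
Qed.

Let eval_fun x i : V -> R^o := fun f => f x ord0 i.

Let eval_in x i : eval_fun x i \in @dual_pred R V.
Proof.
apply: (@dual_bounded_in _ _ _ 1) => [c f g|f]; last by rewrite mul1r C1e_bound.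
by rewrite /eval_fun C1e_coordD C1e_coordZ.
Qed.

(** Evaluation of the i-th coordinate at [x]. *)
Definition eval x i : dual V := MkDual (eval_in x i).

Lemma evalE x i (f : V) : eval x i f = f x ord0 i. Proof. by []. Qed.

(** Evaluations depend continuously on the point, for the dual norm: this is
    where a bound on the derivatives of the test functions matters. *)
Lemma eval_continuous (S : topologicalType) (h : S -> 'rV[R]_d.+1) i :
  (forall j, continuous (fun s => h s ord0 j)) ->
  continuous (fun s => eval (h s) i).
Proof.
move=> ch s; apply/cvgrPdist_le => r r0.
have cl : l1norm (h s - h u) @[u --> s] --> (0 : R).
  rewrite (_ : 0 = \sum_(j < d.+1) `|h s ord0 j - h s ord0 j|); last first.
    by rewrite big1// => j _; rewrite subrr normr0.
  rewrite (_ : (fun u => _) = fun u => \sum_(j < d.+1) `|h s ord0 j - h u ord0 j|); last first.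
    by apply/funext => u; apply: eq_bigr => j _; rewrite !mxE.
  apply: cvg_sum_seq => j; apply: cvg_norm; apply: cvgB; first exact: cvg_cst.
  exact: ch.
move/cvgrPdist_le : cl => /(_ r r0); apply: filterS => u.
rewrite sub0r normrN ger0_norm ?l1norm_ge0// => hr.
apply: le_trans hr; apply: dual_norm_le; first exact: l1norm_ge0.
move=> f; rewrite dual_subE !evalE mulrC.
have := C1e_lipschitz f (h u) (h s - h u) i.
by rewrite (_ : h u + (h s - h u) = h s)// addrC subrK.
Qed.

(** The Riemann sum of level [n] as a functional of the test function; the rows
    of [M] are the values of the path at the dyadic times of level [n]. *)
Definition riemann_functional n (M : 'M[R]_((2 ^ n).+1, d.+1)) : dual V :=
  \sum_(k < 2 ^ n) \sum_(i < d.+1)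
    (M (inord k.+1) i - M (inord k) i) *: eval (row (inord k) M) i.

Lemma riemann_functional_continuous n : continuous (@riemann_functional n).
Proof.
move=> M; have FM : Filter (nbhs M) by exact: nbhs_filter.
apply: (@cvg_sum_seq _ _ (nbhs M) FM) => k.
apply: (@cvg_sum_seq _ _ (nbhs M) FM) => i.
apply: cvgZ.
  by apply: cvgB; exact: coord_continuous.
apply: (@eval_continuous _ (fun M : 'M[R]_((2 ^ n).+1, d.+1) => row (inord k) M)) => j.
rewrite (_ : (fun s => _) = (fun s : 'M[R]_((2 ^ n).+1, d.+1) => s (inord k) j)).
  exact: coord_continuous.
by apply/funext => A; rewrite mxE.
Qed.

Lemma riemann_functionalE n (w : nat -> nat -> 'rV[R]_d.+1) (f : V) :
  riemann_functional (\matrix_(k < (2 ^ n).+1, i < d.+1) w n k ord0 i) f =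
  riemann_sum w f n.
Proof.
rewrite /riemann_functional dual_sumE; apply: eq_bigr => k _.
rewrite dual_sumE /dotrv; apply: eq_bigr => i _.
rewrite dual_scaleE evalE.
have kn : (k < (2 ^ n).+1)%N by rewrite ltnS ltnW.
have -> : row (inord k) (\matrix_(k < (2 ^ n).+1, i < d.+1) w n k ord0 i) = w n k.
  by apply/rowP => j; rewrite !mxE inordK.
have subE m p (A B : 'M[R]_(m, p)) a b : (A - B) a b = A a b - B a b by rewrite !mxE.
have k1 : (k.+1 < (2 ^ n).+1)%N by rewrite ltnS.
by rewrite subE !mxE (inordK kn) (inordK k1) mulrC.
Qed.

End evaluation.

Section pathwise_integral.
Context dis (Omega : measurableType dis) (R : realType) (P : probability Omega R).
Variables (d : nat) (W : R -> Omega -> 'rV[R]_d.+1).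
Hypothesis hW : brownian_motion P W.
Variable T : R.
Hypothesis T0 : 0 < T.
Variable e : R.
Hypotheses (e0 : 0 < e) (e1 : e < 1).
Local Notation V := (C1e d e).
Local Notation bound := (fun n w => refinement_bound e (sample W T w) n).

(** The paths along which the refinement bounds are summable, so that the
    Riemann sums converge in the dual norm. *)
Definition regular_paths : set Omega :=
  [set w | (\sum_(n <oo) (bound n w)%:E < +oo)%E].

Let bound_ge0 n w : 0 <= bound n w.
Proof. by have [C _ /(_ n)[]] := refinement_bound_mean hW T0 e0 e1. Qed.

Let bound_measurable n : measurable_fun setT (bound n).
Proof. by have [C _ /(_ n)[]] := refinement_bound_mean hW T0 e0 e1. Qed.

Let series_measurable : measurable_fun setT (fun w => \sum_(n <oo) (bound n w)%:E)%E.
Proof.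
apply: ge0_emeasurable_sum => // n; first by move=> w _ _; rewrite lee_fin.
by move=> _; exact/measurable_EFinP.
Qed.

Let series_ge0 w : (0 <= \sum_(n <oo) (bound n w)%:E)%E.
Proof. by apply: nneseries_ge0 => n _ _; rewrite lee_fin. Qed.

Lemma measurable_regular_paths : measurable regular_paths.
Proof.
rewrite [X in measurable X](_ : _ = setT `&` [set w | (\sum_(n <oo) (bound n w)%:E < +oo)%E]).
  exact: emeasurable_fun_infty_o.
by rewrite setTI.
Qed.

Lemma ae_regular_paths : {ae P, forall w, regular_paths w}.
Proof.
have [C C0 HC] := refinement_bound_mean hW T0 e0 e1.
have iS : P.-integrable setT (fun w => \sum_(n <oo) (bound n w)%:E)%E.
  apply/integrableP; split => //.
  under eq_integral do rewrite gee0_abs//.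
  rewrite integral_nneseries//; last 2 first.
  - by move=> n; exact/measurable_EFinP.
  - by move=> n w _; rewrite lee_fin.
  apply: (@le_lt_trans _ _ (\sum_(n <oo) (C * rate e ^+ n)%:E)%E).
    apply: lee_nneseries => [n _ _|n _].
    - by apply: integral_ge0 => w _; rewrite lee_fin.
    - by have [] := HC n.
  have r1 : `|rate e| < 1.
    by rewrite ger0_norm; [exact: rate_lt1|exact/ltW/rate_gt0].
  have cg : (\sum_(0 <= k < n) (C * rate e ^+ k)%:E)%E @[n --> \oo] -->
      (C * (1 - rate e)^-1)%:E.
    apply: cvg_EFin; first by apply: nearW => n; rewrite sumEFin.
    rewrite (_ : _ \o _ = series (geometric C (rate e))).
      exact: cvg_geometric_series.
    by apply/funext => n; rewrite /= sumEFin.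
  by rewrite (cvg_lim _ cg)// ltry.
have := integrable_ae measurableT iS; apply: filterS => w /(_ I).
by rewrite ge0_fin_numE.
Qed.

Let riemann n w : dual V :=
  riemann_functional (\matrix_(k < (2 ^ n).+1, i < d.+1) sample W T w n k ord0 i).

Let riemannE n w (f : V) : riemann n w f = riemann_sum (sample W T w) f n.
Proof. exact: riemann_functionalE. Qed.

Let riemann_measurable n : open_measurable_map (riemann n).
Proof.
apply: (open_measurable_continuous (@riemann_functional_continuous R d e n)).
apply: open_measurable_matrix => k i; under eq_fun do rewrite mxE.
have t0 : 0 <= dyad T n k by exact: dyad_ge0.
by apply: (adapted_measurable hW (t := dyad T n k)); exact: adapted_coord.
Qed.

(* The Riemann sums, set to zero along the other paths so that they converge
   everywhere. *)
Let riemann_regular n w : dual V := if w \in regular_paths then riemann n w else 0.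

Let riemann_regular_measurable n : open_measurable_map (riemann_regular n).
Proof.
move=> U oU; have mr := measurable_regular_paths.
rewrite (_ : _ @^-1` U = (regular_paths `&` riemann n @^-1` U) `|`
    (~` regular_paths `&` [set _ | U 0])); last first.
  apply/seteqP; split=> w; rewrite /riemann_regular /=.
    by case: ifPn => [/set_mem|/negP nw] ?; [left|right; split => // /mem_set].
  by case=> -[rw Uw]; [rewrite mem_set|rewrite memNset].
apply: measurableU; apply: measurableI => //.
- exact: riemann_measurable.
- exact: measurableC.
- have [U0|U0] := pselect (U 0).
    by rewrite (_ : [set _ | _] = setT)//; apply/seteqP; split.
  by rewrite (_ : [set _ | _] = set0)//; apply/seteqP; split.
Qed.

(** The pathwise integral: a Borel random element of the dual space that is,
    along almost every path, the limit of the Riemann sums. *)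
Lemma pathwise_integral : exists xi : Omega -> dual V,
  [/\ open_measurable_map xi,
      forall w (f : V), regular_paths w ->
        riemann_sum (sample W T w) f n @[n --> \oo] --> (xi w f : R) &
      forall w, ~ regular_paths w -> xi w = 0].
Proof.
have /choice[xi xiP] : forall w, exists l : dual V,
    riemann_regular n w @[n --> \oo] --> l /\
    forall f : V, riemann_regular n w f @[n --> \oo] --> l f.
  move=> w; rewrite /riemann_regular.
  have [rw|rw] := pselect (regular_paths w); last first.
    rewrite (memNset rw).
    by exists 0; split; [exact: cvg_cst|move=> f; apply: cvg_cst].
  rewrite (mem_set rw).
  have rfin : (\sum_(n <oo) (bound n w)%:E)%E \is a fin_num.
    by rewrite ge0_fin_numE.
  pose M0 := \sum_(k < 2 ^ 0) l1norm (sample W T w 0 k.+1 - sample W T w 0 k).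
  apply: (@dual_limit _ _ _ (bound ^~ w) M0 (fine (\sum_(n <oo) (bound n w)%:E)%E)).
  - move=> f; rewrite riemannE /M0 mulr_suml; apply: le_trans (ler_norm_sum _ _ _) _.
    by apply: ler_sum => k _; rewrite mulrC dotrv_l1norm.
  - move=> n f; rewrite !riemannE mulrC; apply: riemann_sum_refinement => //.
    by move=> m k; exact: sample_double.
  - by [].
  - move=> n; rewrite -lee_fin fineK// -sumEFin -(big_mkord xpredT (fun k => (bound k w)%:E)).
    by apply: nneseries_lim_ge => k _ _; rewrite lee_fin.
exists xi; split.
- apply: (open_measurable_lim riemann_regular_measurable) => w.
  by case: (xiP w).
- move=> w f rw; have [_ /(_ f)] := xiP w; rewrite /riemann_regular mem_set//.
  by under eq_fun do rewrite riemannE.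
- move=> w rw; have [+ _] := xiP w; rewrite /riemann_regular memNset//.
  by move=> h; apply: (cvg_unique _ h); [exact: norm_hausdorff|exact: cvg_cst].
Qed.

End pathwise_integral.

(** * Mean-square convergence of the Riemann sums *)

Section mean_square.
Context dis (Omega : measurableType dis) (R : realType) (P : probability Omega R).
Variables (d : nat) (W : R -> Omega -> 'rV[R]_d.+1).
Hypothesis hW : brownian_motion P W.
Variable T : R.
Hypothesis T0 : 0 < T.
Variable e : R.
Variable f : C1e d e.
Let D : R := d.+1%:R.

Lemma C1e_coord_continuous i : continuous (fun x => f x ord0 i : R).
Proof.
have [df _ _] := C1eP f.
move=> x; apply: (@continuous_comp _ _ _ f (fun y : 'rV[R]_d.+1 => y ord0 i)).
  exact/differentiable_continuous/df.
exact: coord_continuous.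
Qed.

Lemma C1e_coord_adapted t i : 0 <= t ->
  adapted W t (fun w => f (W t w) ord0 i).
Proof.
move=> t0; apply: open_measurable_real.
apply: (open_measurable_continuous (@C1e_coord_continuous i)).
apply: open_measurable_matrix => k j; rewrite (ord1 k).
exact: adapted_coord.
Qed.

Lemma C1e_increment_mean s t i : 0 <= s -> s <= t ->
  mean_le P (fun w => (f (W t w) ord0 i - f (W s w) ord0 i) ^+ 2)
    (`|f| ^+ 2 * (D * (D * (8 * (t - s))))).
Proof.
move=> s0; rewrite le_eqVlt => /predU1P[<-|st].
  rewrite (_ : (fun w => _) = fun=> 0); last first.
    by apply/funext => w; rewrite subrr expr0n.
  by rewrite subrr !mulr0; exact: mean_le_cst.
have t0 : 0 <= t by exact/ltW/(le_lt_trans s0).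
have inc j : mean_le P (fun w => increment W s t j w ^+ 2) (8 * (t - s)).
  split; [|by move=> w; exact: sqr_ge0|by apply: (increment_second_moment hW)].
  by apply: measurable_funX; exact: (measurable_increment hW).
have H := mean_leZ (sqr_ge0 `|f|) (mean_leZ (ler0n R d.+1)
  (@mean_le_sum _ _ _ P _ (index_enum 'I_d.+1) _ _ inc)).
rewrite sumr_ord_const -/D in H; apply: le_mean H.
  apply: measurable_funX; apply: measurable_funB.
    exact: (adapted_measurable hW (@C1e_coord_adapted t i t0)).
  exact: (adapted_measurable hW (@C1e_coord_adapted s i s0)).
move=> w; rewrite sqr_ge0/=.
have := C1e_lipschitz f (W s w) (W t w - W s w) i.
rewrite (_ : W s w + (W t w - W s w) = W t w); last by rewrite addrC subrK.
move=> L; rewrite -(real_normK (num_real (_ - _))).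
apply: (@le_trans _ _ ((`|f| * l1norm (W t w - W s w)) ^+ 2)).
  by apply: lerXn2r; rewrite ?nnegrE// mulr_ge0// l1norm_ge0.
by rewrite exprMn ler_wpM2l ?sqr_ge0// l1norm_sqr.
Qed.

(** The Riemann sum of level [n], written over the finer intervals of level
    [m]. *)
Lemma riemann_sum_coarse (w : nat -> nat -> 'rV[R]_d.+1) n m :
  (forall n k, w n.+1 k.*2 = w n k) -> (n <= m)%N ->
  riemann_sum w f n = \sum_i \sum_(k < 2 ^ m)
    f (w n (k %/ 2 ^ (m - n))%N) ord0 i * (w m k.+1 - w m k) ord0 i.
Proof.
move=> wE nm; rewrite /riemann_sum /dotrv exchange_big/=; apply: eq_bigr => i _.
have div1 j k : (k %/ 2 ^ (j - j))%N = k by rewrite subnn divn1.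
elim: m nm => [|m IH].
  by rewrite leqn0 => /eqP ->; apply: eq_bigr => k _; rewrite div1.
rewrite leq_eqVlt => /predU1P[->|nm].
  by apply: eq_bigr => k _; rewrite div1.
have half a b : (b < 2)%N -> ((a * 2 + b) %/ 2 ^ (m.+1 - n) = a %/ 2 ^ (m - n))%N.
  by move=> b2; rewrite subSn// expnS divnMA divnMDl// (divn_small b2) addn0.
rewrite (dyadic_refinement (g := fun p k => f (w n (k %/ 2 ^ (p - n))%N) ord0 i)
    (B := fun p k => (w p k.+1 - w p k) ord0 i)).
- rewrite IH// [X in _ + X]big1 ?addr0// => k _.
  by rewrite -[k.*2.+1]addn1 -muln2 half// subrr mul0r.
- by move=> l; rewrite -[l.*2]addn0 -muln2 half.
- by move=> l; rewrite -doubleS !wE !mxE; ring.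
Qed.

(** A dyadic time of level [m] lies within T / 2^n after the dyadic time of
    level [n] that precedes it. *)
Lemma dyad_coarse n m k : (n <= m)%N ->
  0 <= dyad T m k - dyad T n (k %/ 2 ^ (m - n)) <= T / 2 ^+ n.
Proof.
move=> nm; set N := (2 ^ (m - n))%N.
have N0 : (0 < N)%N by rewrite expn_gt0.
have p0 j : 0 < 2 ^+ j :> R by exact: exprn_gt0.
have mE : 2 ^+ m = 2 ^+ n * N%:R :> R by rewrite /N natrX -exprD subnKC.
have -> : dyad T m k - dyad T n (k %/ N) = T / 2 ^+ m * (k %% N)%:R.
  rewrite /dyad {1}(divn_eq k N) natrD natrM mE; field.
  by rewrite pnatr_eq0 -lt0n N0 expf_neq0.
have Tm : 0 < T / 2 ^+ m by rewrite divr_gt0.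
rewrite mulr_ge0 ?(ltW Tm)//=.
have -> : T / 2 ^+ n = T / 2 ^+ m * N%:R.
  rewrite mE; field; by rewrite pnatr_eq0 -lt0n N0 expf_neq0.
by rewrite ler_wpM2l ?(ltW Tm)// ler_nat ltnW// ltn_mod.
Qed.

Local Notation S := (fun n w => riemann_sum (sample W T w) f n).

Lemma riemann_sum_measurable n : measurable_fun setT (S n).
Proof.
apply: measurable_sum => k; apply: measurable_sum => i; apply: measurable_funM.
  exact: (adapted_measurable hW (@C1e_coord_adapted _ i (dyad_ge0 T0 n k))).
by apply: (measurable_increment hW); exact: dyad_ge0.
Qed.

(** A bound of Ito isometry type: the difference of two Riemann sums is the
    integral of a simple process, which compares the path at a time and at the coarser dyadic time
    before it. *)
Lemma riemann_sum_mean_square : exists2 C, 0 <= C & forall n m, (n <= m)%N ->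
  mean_le P (fun w => (S m w - S n w) ^+ 2) (C / 2 ^+ n).
Proof.
pose a n := `|f| ^+ 2 * (D * (D * (8 * (T / 2 ^+ n)))).
have D0 : 0 <= D by exact: ler0n.
exists (`|f| ^+ 2 * D ^+ 4 * (8 * T) ^+ 2).
  apply: mulr_ge0; last exact: sqr_ge0.
  by apply: mulr_ge0; [exact: sqr_ge0|exact: exprn_ge0].
move=> n m nm.
pose X i k w := f (sample W T w m k) ord0 i -
   f (sample W T w n (k %/ 2 ^ (m - n))%N) ord0 i.
pose Z i w := \sum_(k < 2 ^ m) X i k w *
   increment W (dyad T m k) (dyad T m k.+1) i w.
have SZ w : S m w - S n w = \sum_i Z i w.
  have sE n' k : sample W T w n'.+1 k.*2 = sample W T w n' k by exact: sample_double.
  rewrite (riemann_sum_coarse sE nm) (riemann_sum_coarse sE (leqnn m)) -sumrB.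
  apply: eq_bigr => i _; rewrite -sumrB; apply: eq_bigr => k _.
  by rewrite (_ : (k %/ 2 ^ (m - m))%N = k) -?mulrBl// subnn divn1.
have mX i k : adapted W (dyad T m k) (X i k).
  apply: measurable_funB; first exact: C1e_coord_adapted (dyad_ge0 T0 _ _).
  apply: (@adapted_le _ _ _ _ _ (dyad T n (k %/ 2 ^ (m - n)))).
    by rewrite -subr_ge0; case/andP: (dyad_coarse k nm).
  exact: C1e_coord_adapted (dyad_ge0 T0 _ _).
have mZ i : measurable_fun setT (Z i).
  apply: measurable_sum => k; apply: measurable_funM.
    exact: (adapted_measurable hW (mX i k)).
  by apply: (measurable_increment hW); exact: dyad_ge0.
have ZP i : mean_le P (fun w => Z i w ^+ 2) (a n * (8 * T)).
  split; [exact: measurable_funX|by move=> w; exact: sqr_ge0|].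
  apply: (@le_trans _ _ (\sum_(k < 2 ^ m) a n * (8 * (dyad T m k.+1 - dyad T m k)))%:E).
    apply: (transform_second_moment hW (s := dyad T m) (t := fun k => dyad T m k.+1)
      (a := fun=> a n) (X := X i)) => k //.
    - exact: dyad_ge0.
    - exact: dyad_ltS.
    - have /andP[dc0 dc1] := dyad_coarse k nm.
      have dc0' := dc0; rewrite subr_ge0 in dc0'.
      have [_ _] := C1e_increment_mean i (dyad_ge0 T0 n (k %/ 2 ^ (m - n))) dc0'.
      move=> /le_trans; apply; rewrite lee_fin.
      by rewrite !(ler_wpM2l _) ?sqr_ge0.
  under eq_bigr do rewrite dyadS.
  rewrite sumr_ord_const lee_fin natrX le_eqVlt; apply/orP; left; apply/eqP.
  by field; rewrite expf_neq0.
have H := mean_leZ D0 (@mean_le_sum _ _ _ P _ (index_enum 'I_d.+1) _ _ ZP).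
apply: mean_leW (le_mean _ _ H).
- rewrite sumr_ord_const -/D /a le_eqVlt; apply/orP; left; apply/eqP.
  by field; rewrite expf_neq0.
- by apply: measurable_funX; apply: measurable_funB; exact: riemann_sum_measurable.
move=> w; rewrite sqr_ge0/= SZ -(real_normK (num_real _)).
apply: le_trans (sqr_sum_norm_le (fun i => Z i w)).
apply: lerXn2r; rewrite ?nnegrE ?sumr_ge0//.
exact: ler_norm_sum.
Qed.

(** An almost sure limit of the Riemann sums is their limit in mean square. *)
Lemma riemann_sum_L2 (I : Omega -> R) : measurable_fun setT I ->
  {ae P, forall w, S n w @[n --> \oo] --> I w} ->
  (\int[P]_w ((S n w - I w) ^+ 2)%:E)%E @[n --> \oo] --> 0%E.
Proof.
move=> mI SI; have [C C0 SC] := riemann_sum_mean_square.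
pose u n m w : \bar R := ((S (n + m)%N w - S n w) ^+ 2)%:E.
have u0 n m w : (0 <= u n m w)%E by rewrite lee_fin sqr_ge0.
have mS n m : measurable_fun setT (u n m).
  apply/measurable_EFinP; apply: measurable_funX.
  by apply: measurable_funB; exact: riemann_sum_measurable.
have mSI n : measurable_fun setT (fun w => ((S n w - I w) ^+ 2)%:E : \bar R).
  apply/measurable_EFinP; apply: measurable_funX.
  by apply: measurable_funB => //; exact: riemann_sum_measurable.
have mlim n : measurable_fun setT (fun w => limn_einf (u n ^~ w)).
  rewrite (_ : (fun w => _) = (fun w => - limn_esup (fun m => - u n m w))%E); last first.
    by apply/funext => w; rewrite limn_esupN oppeK.
  apply: measurableT_comp => //; apply: measurable_fun_limn_esup => m.
  exact: measurableT_comp.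
have bnd n : (\int[P]_w ((S n w - I w) ^+ 2)%:E <= (C / 2 ^+ n)%:E)%E.
  have -> : (\int[P]_w ((S n w - I w) ^+ 2)%:E =
      \int[P]_w limn_einf (u n ^~ w))%E.
    apply: ge0_ae_eq_integral => //.
    - by move=> w _; rewrite lee_fin sqr_ge0.
    - move=> w _; rewrite limn_einf_lim; apply: lime_ge; first exact: is_cvg_einfs.
      by apply: nearW => k; apply: le_ereal_inf_tmp => _ [m _ <-].
    apply: filterS SI => w SIw _.
    suff c : u n m w @[m --> \oo] --> ((S n w - I w) ^+ 2)%:E.
      by rewrite (cvg_limn_einf_sup c).1.
    apply: cvg_EFin; first exact: nearW.
    have SIn : S (n + m)%N w @[m --> \oo] --> I w.
      exact: (cvg_comp _ _ (cvg_addnl n) SIw).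
    rewrite -sqrrN opprB expr2 (_ : _ \o _ =
      (fun m => (S (n + m)%N w - S n w) * (S (n + m)%N w - S n w))); last first.
      by apply/funext => m; rewrite /= expr2.
    by apply: cvgM; (apply: cvgB; [exact: SIn|exact: cvg_cst]).
  apply: le_trans (fatou _ _ _ _) _ => //.
  rewrite limn_einf_lim; apply: lime_le; first exact: is_cvg_einfs.
  apply: nearW => k; apply: (@le_trans _ _ (\int[P]_w u n k w)%E).
    by apply: ereal_inf_lbound; exists k => /=.
  by have [] := SC n (n + k)%N (leq_addr _ _).
have c0 : (C / 2 ^+ n)%:E @[n --> \oo] --> (0%E : \bar R).
  apply: cvg_EFin; first exact: nearW.
  rewrite (_ : _ \o _ = geometric C 2^-1); last first.
    by apply/funext => n; rewrite /= exprVn.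
  by apply: cvg_geometric; rewrite ger0_norm// invf_lt1// ltr1n.
apply: (squeeze_cvge _ (cvg_cst 0%E) c0); apply: nearW => n.
rewrite bnd andbT; apply: integral_ge0 => w _.
by rewrite lee_fin sqr_ge0.
Qed.

End mean_square.

(** * Approximation of the integrand by simple processes *)

(** Bounded convergence on [0, T]; convergence at 0 is not required, because the
    simple processes below vanish there. *)
Lemma bounded_cvg_integral (R : realType) (T B : R) (F : nat -> R -> R) (G : R -> R) :
  0 < T ->
  (forall n, measurable_fun `[0, T]%classic (F n)) ->
  (forall n t, 0 <= t <= T -> `|F n t| <= B) ->
  (forall t, 0 < t <= T -> F n t @[n --> \oo] --> G t) ->
  measurable_fun `[0, T]%classic G /\
  (\int[lebesgue_measure]_(t in [set` `[0, T]%R]) (F n t)%:E)%E @[n --> \oo] -->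
  (\int[lebesgue_measure]_(t in [set` `[0, T]%R]) (G t)%:E)%E.
Proof.
move=> T0 mF FB FG.
have mG : measurable_fun `[0, T]%classic G.
  apply/measurable_fun_itv_obnd_cbndP.
  apply: (@measurable_fun_cvg _ _ _ _ F) => [n|t].
    by apply/measurable_fun_itv_obnd_cbndP; exact: mF.
  by rewrite /= in_itv/=; exact: FG.
split => //.
have iB : (@lebesgue_measure R).-integrable `[0, T] (EFin \o cst B).
  apply: measurable_bounded_integrable => //=.
    by rewrite /= lebesgue_measure_itv/= lte_fin T0 -EFinB ltry.
  by exists `|B|; split => // x Bx y _; exact: ltW.
have [] := @dominated_convergence _ _ R lebesgue_measure `[0, T]%classic _
  (fun n t => (F n t)%:E) (EFin \o G) (EFin \o cst B) _ _ _ iB _ => //.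
- by move=> n; apply/measurable_EFinP; exact: mF.
- exact/measurable_EFinP.
- exists [set 0]; split => //; first exact: lebesgue_measure_set1.
  move=> t /=; apply: contra_notP => t0; rewrite in_itv/= => /andP[t0' tT].
  apply: cvg_EFin; first exact: nearW.
  by apply: FG; rewrite tT andbT lt_neqAle t0' andbT; apply/eqP => /esym.
- by apply: aeW => t n; rewrite /= in_itv/= => tT; rewrite lee_fin FB.
Qed.

Lemma enorm_rv_sqr (R : realType) n (v : 'rV[R]_n) :
  enorm v ^+ 2 = \sum_j v ord0 j ^+ 2.
Proof.
rewrite /enorm big_ord1 sqr_sqrtr//.
by apply: sumr_ge0 => j _; exact: sqr_ge0.
Qed.

Section dyadic_simple_process.
Context dis (Omega : measurableType dis) (R : realType) (P : probability Omega R).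
Hypothesis hP : measure_is_complete P.
Variables (d : nat) (W : R -> Omega -> 'rV[R]_d.+1).
Hypothesis hW : brownian_motion P W.
Variable T : R.
Hypothesis T0 : 0 < T.
Variables (e : R) (f : C1e d e).

(** The simple process that freezes f(W) at the left end of every dyadic interval
    of level [n]. *)
Definition dyadic_process n : simple_process (Omega := Omega) (R := R) d.+1 :=
  [seq Elementary (dyad T n k) (dyad T n k.+1) (fun w => f (W (dyad T n k) w))
  | k <- index_iota 0 (2 ^ n)].

Lemma dyadic_process_adapted n :
  simple_adapted (natural_filtration W) T (dyadic_process n).
Proof.
have H k : (k < 2 ^ n)%N -> elementary_adapted (natural_filtration W) T
    (Elementary (dyad T n k) (dyad T n k.+1) (fun w => f (W (dyad T n k) w))).
  move=> kn; split => /=.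
  - exact: dyad_ge0.
  - exact/ltW/dyad_ltS.
  - by rewrite -[leRHS](dyad_max T n); exact: dyad_le.
  - move=> i B mB.
    exact: (adaptedP _ _ _).1 (@C1e_coord_adapted _ _ _ _ W e f _ i (dyad_ge0 T0 n k)) B mB.
  - exists `|f| => w; apply: le_trans (C1e_sup_bound f (W (dyad T n k) w)).
    by rewrite lerDl enorm_ge0.
rewrite /simple_adapted /dyadic_process.
have : {in index_iota 0 (2 ^ n), forall k, (k < 2 ^ n)%N}.
  by move=> k; rewrite mem_index_iota.
elim: (index_iota _ _) => [_|k s IH ks] /=; first exact: List.Forall_nil.
apply: List.Forall_cons; first by apply: H; apply: ks; rewrite mem_head.
by apply: IH => j js; apply: ks; rewrite inE js orbT.
Qed.

Lemma dyadic_process_integral n w :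
  simple_integral W (dyadic_process n) w = riemann_sum (sample W T w) f n.
Proof. by rewrite /simple_integral big_map big_mkord. Qed.

Lemma dyadic_process_value n t w : simple_value (dyadic_process n) t w =
  \sum_(k < 2 ^ n) (\1_(`]dyad T n k, dyad T n k.+1]%classic : set R) t *:
                     f (W (dyad T n k) w)).
Proof. by rewrite /simple_value big_map big_mkord. Qed.

(** At a time [t] of ]0, T], the simple process is [f] along the path at an
    earlier time, close to [t] and not depending on the path. *)
Lemma dyadic_process_nearby n t : 0 < t <= T -> exists s, [/\ 0 <= s,
  t - T / 2 ^+ n <= s, s < t &
  forall w, simple_value (dyadic_process n) t w = f (W s w)].
Proof.
move=> /andP[t0 tT].
have ex : exists j, t <= dyad T n j by exists (2 ^ n)%N; rewrite dyad_max.
(* the first dyadic time at or after [t] ends the interval that contains [t] *)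
case: (ex_minnP ex) => -[|k] tk kmin.
  by move: tk; rewrite /dyad mulr0 mul0r leNgt t0.
have kt : dyad T n k < t.
  by rewrite ltNge; apply/negP => /kmin; rewrite ltnn.
have k2 : (k < 2 ^ n)%N by apply: kmin; rewrite dyad_max.
exists (dyad T n k); split => //; first exact: dyad_ge0.
  by rewrite lerBlDr -lerBlDl -(dyadS T n k) lerD2r.
move=> w; rewrite dyadic_process_value (bigD1 (Ordinal k2))//= indicE mem_set/=; last first.
  by rewrite in_itv/= kt tk.
rewrite scale1r big1 ?addr0// => j jk; rewrite indicE memNset ?scale0r//=.
rewrite in_itv/= => /andP[jt tj].
have /negP := jk; apply; apply/eqP/val_inj => /=.
have [jk'|jk'|//] := ltngtP j k.
  by have := lt_le_trans kt (le_trans tj (dyad_le T0 n jk')); rewrite ltxx.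
by have := lt_le_trans jt (le_trans tk (dyad_le T0 n jk')); rewrite ltxx.
Qed.

Lemma dyadic_process_outside n t w : ~ (0 < t <= T) ->
  simple_value (dyadic_process n) t w = 0.
Proof.
move=> tT; rewrite dyadic_process_value big1// => k _.
rewrite indicE memNset ?scale0r//= in_itv/= => /andP[kt tk]; apply: tT.
rewrite (le_lt_trans _ kt) ?dyad_ge0//= (le_trans tk)//.
by rewrite -[leRHS](dyad_max T n) dyad_le.
Qed.

Lemma dyadic_process_bound n t w j :
  `|simple_value (dyadic_process n) t w ord0 j| <= `|f|.
Proof.
have [tT|tT] := pselect (0 < t <= T); last first.
  by rewrite dyadic_process_outside// mxE normr0.
by have [s [_ _ _ ->]] := dyadic_process_nearby n tT; exact: C1e_bound.
Qed.

Lemma dyadic_process_cvg t w j : {within `[0, +oo[, continuous (W ^~ w)} ->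
  0 < t <= T ->
  simple_value (dyadic_process n) t w ord0 j @[n --> \oo] --> (f (W t w) ord0 j : R).
Proof.
move=> /continuous_within_itvcyP[cW _] tT.
have /choice[s sP] n := dyadic_process_nearby n tT.
have t0 : 0 < t by case/andP: tT.
rewrite (_ : (fun n => _) = (fun n => f (W (s n) w) ord0 j)); last first.
  by apply/funext => n; have [_ _ _ ->] := sP n.
have st : s n @[n --> \oo] --> t.
  have c0 : t - T / 2 ^+ n @[n --> \oo] --> t.
    rewrite -[X in _ --> X]subr0; apply: cvgB; first exact: cvg_cst.
    rewrite (_ : (fun n => _) = geometric T 2^-1); last first.
      by apply/funext => n; rewrite /= exprVn.
    by apply: cvg_geometric; rewrite ger0_norm// invf_lt1// ltr1n.
  apply: (squeeze_cvgr _ c0 (cvg_cst t)); apply: nearW => n.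
  by have [_ -> /ltW ->] := sP n.
have Wt : W (s n) w @[n --> \oo] --> W t w.
  have cWt : W x w @[x --> t] --> W t w by apply: cW; rewrite in_itv/= t0.
  exact: (cvg_comp _ _ st cWt).
exact: (cvg_comp _ _ Wt (@C1e_coord_continuous _ _ _ f j (W t w))).
Qed.

Lemma measurable_dyadic_process n j :
  measurable_fun setT (fun z : Omega * measurableTypeR R =>
    simple_value (dyadic_process n) z.2 z.1 ord0 j).
Proof.
rewrite (_ : (fun z => _) = (fun z : Omega * measurableTypeR R => \sum_(k < 2 ^ n)
    \1_(`]dyad T n k, dyad T n k.+1]%classic : set R) z.2 *
    f (W (dyad T n k) z.1) ord0 j)); last first.
  apply/funext => z; rewrite dyadic_process_value summxE.
  by apply: eq_bigr => k _; rewrite mxE.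
apply: measurable_sum => k.
have mi : measurable_fun setT
    (\1_(`]dyad T n k, dyad T n k.+1]%classic) : measurableTypeR R -> R).
  exact: measurable_indic.
have mf := adapted_measurable hW (@C1e_coord_adapted _ _ _ _ W e f _ j (dyad_ge0 T0 n k)).
apply: measurable_funM; first exact: (measurableT_comp mi measurable_snd).
exact: (measurableT_comp mf measurable_fst).
Qed.

Local Notation D := (`[0, T]%classic : set (measurableTypeR R)).
Let gap n m (z : Omega * measurableTypeR R) : R :=
  enorm (simple_value (dyadic_process n) z.2 z.1 -
         simple_value (dyadic_process m) z.2 z.1) ^+ 2.

Let gapE n m z : gap n m z =
  \sum_j (simple_value (dyadic_process n) z.2 z.1 ord0 j -
          simple_value (dyadic_process m) z.2 z.1 ord0 j) ^+ 2.
Proof. by rewrite /gap enorm_rv_sqr; apply: eq_bigr => j _; rewrite !mxE. Qed.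

Let measurable_gap n m : measurable_fun setT (gap n m).
Proof.
rewrite (_ : gap n m = fun z => \sum_j (simple_value (dyadic_process n) z.2 z.1 ord0 j -
          simple_value (dyadic_process m) z.2 z.1 ord0 j) ^+ 2).
  apply: measurable_sum => j; apply: measurable_funX.
  by apply: measurable_funB; exact: measurable_dyadic_process.
by apply/funext => z; rewrite gapE.
Qed.

Let error n (w : Omega) (t : R) : R :=
  enorm (simple_value (dyadic_process n) t w - f (W t w)) ^+ 2.

Let errorE n w t : error n w t =
  \sum_j (simple_value (dyadic_process n) t w ord0 j - f (W t w) ord0 j) ^+ 2.
Proof.
have subE (A B : 'rV[R]_d.+1) j : (A - B) ord0 j = A ord0 j - B ord0 j by rewrite !mxE.
by rewrite /error enorm_rv_sqr; apply: eq_bigr => j _; rewrite subE.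
Qed.

Let B : R := d.+1%:R * (2 * `|f|) ^+ 2.

Let sum_sqr_bound (a b : 'I_d.+1 -> R) : (forall j, `|a j| <= `|f|) ->
  (forall j, `|b j| <= `|f|) -> `|\sum_j (a j - b j) ^+ 2| <= B.
Proof.
move=> af bf; apply: le_trans (ler_norm_sum _ _ _) _.
rewrite /B -sumr_ord_const; apply: ler_sum => j _.
rewrite normrX; apply: lerXn2r; rewrite ?nnegrE// ?mulr_ge0//.
by apply: le_trans (ler_normB _ _) _; rewrite mulr_natl mulr2n lerD.
Qed.

Let continuous_path w := {within `[0, +oo[, continuous (W ^~ w)}.

Let gap_cvg n w t : continuous_path w -> 0 < t <= T ->
  gap n m (w, t) @[m --> \oo] --> error n w t.
Proof.
move=> cw tT; under eq_fun do rewrite gapE; rewrite errorE.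
apply: cvg_sum_seq => j; under eq_fun do rewrite expr2; rewrite expr2.
by apply: cvgM; (apply: cvgB; [exact: cvg_cst|exact: dyadic_process_cvg]).
Qed.

Let error_cvg w t : continuous_path w -> 0 < t <= T ->
  error n w t @[n --> \oo] --> (0 : R).
Proof.
move=> cw tT.
have z : \sum_(j < d.+1) (f (W t w) ord0 j - f (W t w) ord0 j) ^+ 2 = 0.
  by rewrite big1// => j _; rewrite subrr expr0n.
have c : error n w t @[n --> \oo] -->
    \sum_(j < d.+1) (f (W t w) ord0 j - f (W t w) ord0 j) ^+ 2.
  under eq_fun do rewrite errorE.
  apply: cvg_sum_seq => j; under eq_fun do rewrite expr2; rewrite expr2.
  by apply: cvgM; (apply: cvgB; [exact: dyadic_process_cvg|exact: cvg_cst]).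
by rewrite z in c.
Qed.

Let gap_integral n w : continuous_path w ->
  measurable_fun D (error n w) /\
  (\int[lebesgue_measure]_(t in D) (gap n m (w, t))%:E)%E @[m --> \oo] -->
  (\int[lebesgue_measure]_(t in D) (error n w t)%:E)%E.
Proof.
move=> cw; apply: (bounded_cvg_integral (B := B) T0).
- move=> m; apply: measurable_funTS.
  exact: (measurableT_comp (measurable_gap n m) (measurable_pair1 w)).
- move=> m t _; rewrite gapE; apply: sum_sqr_bound => j; exact: dyadic_process_bound.
- by move=> t tT; exact: gap_cvg.
Qed.

Let Phi n w : \bar R := (\int[lebesgue_measure]_(t in D) (error n w t)%:E)%E.

Let Phi_cvg w : continuous_path w -> Phi n w @[n --> \oo] --> 0%E.
Proof.
move=> cw.
have eB n t : `|error n w t| <= B.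
  rewrite errorE; apply: sum_sqr_bound => j; first exact: dyadic_process_bound.
  exact: C1e_bound.
have [_] := @bounded_cvg_integral R T B (fun n => error n w) (cst 0) T0
  (fun n => (gap_integral n cw).1) (fun n t _ => eB n t)
  (fun t => @error_cvg w t cw).
by rewrite [X in _ --> X -> _]integral0.
Qed.

Let Phi_bound n w : continuous_path w -> (`|Phi n w| <= (B * T)%:E)%E.
Proof.
move=> cw; have Phi0 : (0 <= Phi n w)%E.
  by apply: integral_ge0 => t _; rewrite lee_fin sqr_ge0.
rewrite gee0_abs// /Phi.
apply: (@le_trans _ _ (\int[lebesgue_measure]_(t in D) cst B%:E t)%E).
  apply: ge0_le_integral => //=.
  - by move=> t _; rewrite lee_fin sqr_ge0.
  - by apply/measurable_EFinP; exact: (gap_integral n cw).1.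
  - move=> t _; rewrite lee_fin; apply: le_trans (ler_norm _) _.
    rewrite errorE; apply: sum_sqr_bound => j; first exact: dyadic_process_bound.
    exact: C1e_bound.
rewrite integral_cst// /= lebesgue_measure_itv/= lte_fin T0 -EFinB subr0.
by rewrite -EFinM.
Qed.

(** The inner integral is a limit of measurable functions along continuous
    paths only; completeness of the probability space takes care of the rest. *)
Let measurable_Phi n : measurable_fun setT (Phi n).
Proof.
pose G m w := (\int[lebesgue_measure]_(t in D) (gap n m (w, t))%:E)%E.
have mG m : measurable_fun setT (G m).
  pose h (z : Omega * measurableTypeR R) : \bar R := (gap n m z * \1_D z.2)%:E.
  rewrite (_ : G m = fubini_F (@lebesgue_measure R) h).
    apply: measurable_fun_fubini_tonelli_F.
      apply/measurable_EFinP; apply: measurable_funM; first exact: measurable_gap.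
      have mi : measurable_fun setT (\1_D : measurableTypeR R -> R).
        exact: measurable_indic.
      exact: (measurableT_comp mi measurable_snd).
    by move=> z; rewrite /h lee_fin mulr_ge0 ?sqr_ge0// indicE ler0n.
  apply/funext => w; rewrite /G /fubini_F [LHS]integral_mkcond.
  apply: eq_integral => t _; rewrite patchE /h/= indicE.
  by case: ifPn => tD; rewrite ?mulr1 ?mulr0.
apply: (ae_measurable_fun hP _ (measurable_fun_limn_esup mG)).
apply: filterS (bm_continuous hW) => w cw _.
by rewrite (cvg_limn_einf_sup (gap_integral n cw).2).2.
Qed.

Lemma dyadic_process_sqdist :
  ito_sqdist P T (dyadic_process n) (fun t w => f (W t w)) @[n --> \oo] --> 0%E.
Proof.
have iB : P.-integrable setT (fun=> (B * T)%:E).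
  exact: finite_measure_integrable_cst.
have Phi0 : {ae P, forall w, setT w -> Phi ^~ w @ \oo --> cst 0%E w}.
  by apply: filterS (bm_continuous hW) => w cw _; exact: Phi_cvg.
have PhiB : {ae P, forall w n, setT w -> (`|Phi n w| <= (B * T)%:E)%E}.
  by apply: filterS (bm_continuous hW) => w cw n _; exact: Phi_bound.
have [_ _] := dominated_convergence measurableT measurable_Phi
  (measurable_cst _) Phi0 iB PhiB.
by rewrite integral0.
Qed.

End dyadic_simple_process.

(** * Pathwise redefinition of the Ito integral *)

Theorem theorem35 (R : realType) (disp : measure_display)
    (Omega : measurableType disp) (P : probability Omega R)
    (hP : measure_is_complete P) (d : nat)
    (W : R -> Omega -> 'rV[R]_d.+1) (hW : brownian_motion P W)
    (T : R) (hT : 0 < T) (e : R) (he0 : 0 < e) (he1 : e < 1) :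
  has_pathwise_redefinition P
    (fun phi : C1e d e =>
       [set I | is_ito_integral P (natural_filtration W) W T
                  (fun t w => phi (W t w)) I]).
Proof.
have [xi [mxi xi_lim xi0]] := pathwise_integral hW hT he0 he1.
exists xi; split=> [|phi]; first exact: borel_measurable_fun.
have mreg := measurable_regular_paths hW hT he0 he1.
(* [xi] evaluated at [phi] is a limit of Riemann sums, cut off along the paths
   where they need not converge. *)
have mxiphi : measurable_fun setT (fun w => xi w phi : R).
  apply: (@measurable_fun_cvg _ _ _ setT (fun n w =>
    riemann_sum (sample W T w) phi n * \1_(regular_paths W T e) w)) => [n|w _].
    apply: measurable_funM; first exact: (riemann_sum_measurable hW hT).
    exact: measurable_indic.
  have [rw|rw] := pselect (regular_paths W T e w).
    by under eq_fun do rewrite indicE (mem_set rw) mulr1; exact: xi_lim.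
  under eq_fun do rewrite indicE (memNset rw) mulr0.
  by rewrite xi0//; apply: cvg_cst.
(* the pathwise integral is itself a version of the Ito integral *)
exists (fun w => xi w phi); last by apply: aeW.
split => //; exists (dyadic_process W T phi); split.
- by move=> n; exact: dyadic_process_adapted.
- exact: dyadic_process_sqdist.
under eq_fun do under eq_integral do rewrite dyadic_process_integral.
apply: (riemann_sum_L2 hW hT mxiphi).
by apply: filterS (ae_regular_paths hW hT he0 he1) => w; exact: xi_lim.
Qed.
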